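(* Assume $\Bbbk$ has characteristic zero. Every indecomposable projective object $Q$ of $\mathcal F(\mathbf{FA})$ satisfies exactly one of: (1) $Q\cong\Lambda^n(P^{\mathbf{FA}})$ for a unique $n\in\mathbb N$; (2) $Q\cong S_\lambda(\overline P)$ for a unique partition $\lambda\vdash n$ with $n\ge1$ and $\lambda\neq(1^n)$. Conversely, all the objects listed in (1) and (2) are indecomposable projectives, and they are pairwise non-isomorphic.
   Context: Let $\Bbbk$ be a field. $\mathbf{FA}$ denotes the category of finite sets and all maps, and $\mathbf{FI}$, $\mathbf{FS}$, $\mathbf{FB}$ its wide subcategories of injections, surjections and bijections respectively; $\mathbf n=\{1,\dots,n\}$ for $n\in\mathbb N$ ($\mathbf 0=\emptyset$), and $\mathfrak S_n$ is the symmetric group. For a category $\mathcal C$, $\Bbbk\mathcal C(X,Y)$ is the $\Bbbk$-vector space with basis $\mathcal C(X,Y)$. A $\Bbbk\mathbf{FA}$-module is a functor from $\mathbf{FA}$ to $\Bbbk$-vector spaces (these form the abelian category $\mathcal F(\mathbf{FA})$); $\otimes$ denotes the pointwise tensor product over $\Bbbk$, and $\hom_{\Bbbk\mathbf{FA}}$ denotes natural transformations. $P^{\mathbf{FA}}_{\mathbf n}:=\Bbbk\mathbf{FA}(\mathbf n,-)$, so $P^{\mathbf{FA}}_{\mathbf n}(X)\cong\Bbbk[X]^{\otimes n}$ (where $\Bbbk[X]$ has basis $\{[x]:x\in X\}$), with the right $\mathfrak S_n$-action by precomposition, equivalently place permutation of tensor factors; write $P^{\mathbf{FA}}:=P^{\mathbf{FA}}_{\mathbf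 1}$. Let $\overline{\Bbbk}$ be the functor with value $\Bbbk$ on non-empty sets (all maps acting by the identity) and $0$ on $\emptyset$, and $\Bbbk_{\mathbf 0}$ the functor with value $\Bbbk$ on $\emptyset$ and $0$ on non-empty sets. $\overline P$ is the kernel of the surjection $P^{\mathbf{FA}}\to\overline\Bbbk$, $[x]\mapsto 1$; thus $\overline P(X)=\{\sum_x a_x[x]:\sum_x a_x=0\}$. For $n\ge1$, $\overline P^{\otimes n}$ is the $n$-fold pointwise tensor power, a subfunctor of $P^{\mathbf{FA}}_{\mathbf n}$ stable under the place-permutation right action of $\mathfrak S_n$; by convention $\overline P^{\otimes 0}:=\overline\Bbbk$. For a partition $\lambda\vdash n$, $S_\lambda$ is the associated simple $\Bbbk\mathfrak S_n$-module, with $S_{(n)}$ trivial and $S_{(1^n)}=\mathsf{sgn}_n$ the sign representation. For a $\Bbbk\mathbf{FA}$-module $F$, $S_\lambda(F):=F^{\otimes n}\otimes_{\mathfrak S_n}S_\lambda$ (using the place-permutation right action on $F^{\otimes n}$), and $\Lambda^n(F):=S_{(1^n)}(F)$ is the $n$-th exterior power; conventions: $\Lambda^0(P^{\mathbf{FA}})=\Bbbk$ (the constant functor), $\Lambda^0(\overline P)=\overline\Bbbk$, $\Lambda^{-1}(\overline P)=\Bbbk_{\mathbf 0}$. *)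

(* Defs.v *)
From mathcomp Require Import all_boot all_order all_algebra all_fingroup.
Set Implicit Arguments. Unset Strict Implicit. Unset Printing Implicit Defensive.
Import GRing.Theory.
Local Open Scope ring_scope.

(* ---------- The category FA, via its skeleton: objects 'I_n, all maps ---------- *)
Definition idf (n : nat) : {ffun 'I_n -> 'I_n} := [ffun i => i].
Definition compf (m n p : nat) (f : {ffun 'I_m -> 'I_n}) (g : {ffun 'I_n -> 'I_p})
  : {ffun 'I_m -> 'I_p} := [ffun i => g (f i)].

Record FAmod (K : fieldType) := {
  fobj : nat -> lmodType K;
  fact : forall m n, {ffun 'I_m -> 'I_n} -> fobj m -> fobj n;
  fact_lin : forall m n (f : {ffun 'I_m -> 'I_n}) (a : K) (x y : fobj m),
      fact f (a *: x + y) = a *: fact f x + fact f y;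
  fact_id : forall n (x : fobj n), fact (idf n) x = x;
  fact_comp : forall m n p (f : {ffun 'I_m -> 'I_n}) (g : {ffun 'I_n -> 'I_p}) x,
      fact (compf f g) x = fact g (fact f x) }.
Arguments fact {K} _ {m n} _ _.
Arguments fobj {K} _ _.

Definition is_nat (K : fieldType) (M N : FAmod K) (phi : forall m, fobj M m -> fobj N m) :=
  (forall m (a : K) (x y : fobj M m), phi m (a *: x + y) = a *: phi m x + phi m y) /\
  (forall m n (f : {ffun 'I_m -> 'I_n}) x, phi n (fact M f x) = fact N f (phi m x)).

(* projective object of F(FA): Hom(Q,-) preserves epimorphisms
   (epimorphisms of functors to vector spaces = pointwise surjective). *)
Definition projective (K : fieldType) (Q : FAmod K) : Prop :=
  forall (M N : FAmod K) (pi : forall m, fobj M m -> fobj N m)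
         (g : forall m, fobj Q m -> fobj N m),
    is_nat pi -> (forall m y, exists x, pi m x = y) -> is_nat g ->
    exists h : forall m, fobj Q m -> fobj M m,
      is_nat h /\ forall m x, pi m (h m x) = g m x.

Definition is_subfun (K : fieldType) (Q : FAmod K) (A : forall m, fobj Q m -> Prop) :=
  (forall m, A m 0) /\
  (forall m (a : K) x y, A m x -> A m y -> A m (a *: x + y)) /\
  (forall m n (f : {ffun 'I_m -> 'I_n}) x, A m x -> A n (fact Q f x)).

Definition indecomposable (K : fieldType) (Q : FAmod K) : Prop :=
  (exists m (x : fobj Q m), x <> 0) /\
  forall A B : forall m, fobj Q m -> Prop,
    is_subfun A -> is_subfun B ->
    (forall m x, A m x -> B m x -> x = 0) ->
    (forall m x, exists a b, A m a /\ B m b /\ x = a + b) ->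
    (forall m x, A m x -> x = 0) \/ (forall m x, B m x -> x = 0).

(* ---------- P_n = kFA(n,-):  P_n(m) = K[ 'I_m ]^{(x) n} = K^{maps n -> m} ---------- *)
Notation Pn K n m := {ffun {ffun 'I_n -> 'I_m} -> K^o} (only parsing).

(* functoriality: postcomposition on the basis *)
Definition pushPn (K : fieldType) n m m' (f : {ffun 'I_m -> 'I_m'}) (v : Pn K n m) : Pn K n m' :=
  [ffun h : {ffun 'I_n -> 'I_m'} => \sum_(g : {ffun 'I_n -> 'I_m} | compf g f == h) v g].

(* right place-permutation action of s in S_n (precomposition): delta_g . s = delta_(g o s) *)
Definition permPn (K : fieldType) n m (s : 'S_n) (v : Pn K n m) : Pn K n m :=
  [ffun h : {ffun 'I_n -> 'I_m} => v [ffun i => h ((s^-1)%g i)]].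

(* ---------- partitions, Young tableau (filled row by row), Young symmetrizer ---------- *)
Definition is_partition (la : seq nat) : bool :=
  sorted geq la && all (fun x => 0 < x)%N la.

Definition rowOf (la : seq nat) (i : nat) : nat :=
  count (fun r => sumn (take r.+1 la) <= i)%N (iota 0 (size la)).
Definition colOf (la : seq nat) (i : nat) : nat :=
  (i - sumn (take (rowOf la i) la))%N.

Definition rowGroup n (la : seq nat) : {set 'S_n} :=
  [set s : 'S_n | [forall i, rowOf la (s i) == rowOf la i]].
Definition colGroup n (la : seq nat) : {set 'S_n} :=
  [set s : 'S_n | [forall i, colOf la (s i) == colOf la i]].

(* v |-> v . c_la,  c_la = (sum_{p in R} p)(sum_{q in C} sgn(q) q) *)
Definition young (K : fieldType) n m (la : seq nat) (v : Pn K n m) : Pn K n m :=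
  \sum_(p in rowGroup n la) \sum_(q in colGroup n la)
     ((-1) ^+ odd_perm q) *: permPn q (permPn p v).

Definition ptensor (K : fieldType) n m (w : n.-tuple {ffun 'I_m -> K^o}) : Pn K n m :=
  [ffun g : {ffun 'I_n -> 'I_m} => \prod_(i < n) (tnth w i) (g i)].

(* Pbar^{(x) n}(m): span of pure tensors with all factors in Pbar(m) (coefficient sum 0) *)
Definition inPbarT (K : fieldType) n m (v : Pn K n m) : Prop :=
  exists s : seq (K * n.-tuple {ffun 'I_m -> K^o}),
    (forall c, c \in s -> forall i, \sum_(x < m) (tnth c.2 i) x = 0) /\
    v = \sum_(c <- s) c.1 *: ptensor c.2.

(* Lambda^n(P)(m) = P^{(x)n}(m) . c_(1^n) ;  S_la(Pbar)(m) = Pbar^{(x)n}(m) . c_la *)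
Definition LamSub (K : fieldType) n m (x : Pn K n m) : Prop :=
  exists v : Pn K n m, x = young (nseq n 1%N) v.
Definition SchurBarSub (K : fieldType) n (la : seq nat) m (x : Pn K n m) : Prop :=
  exists v : Pn K n m, inPbarT v /\ x = young la v.

Definition isoSub (K : fieldType) (Q : FAmod K) n (S : forall m, Pn K n m -> Prop) : Prop :=
  exists phi : forall m, fobj Q m -> Pn K n m,
    (forall m (a : K) x y, phi m (a *: x + y) = a *: phi m x + phi m y) /\
    (forall m, injective (phi m)) /\
    (forall m x, S m x <-> exists q, phi m q = x) /\
    (forall m m' (f : {ffun 'I_m -> 'I_m'}) q, phi m' (fact Q f q) = pushPn f (phi m q)).

Inductive FAidx := IdxLam of nat | IdxSchur of seq nat.

Definition validIdx (i : FAidx) : Prop :=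
  match i with
  | IdxLam _ => True
  | IdxSchur la => is_partition la /\ la <> [::] /\ la <> nseq (sumn la) 1%N
  end.

Definition isoIdx (K : fieldType) (Q : FAmod K) (i : FAidx) : Prop :=
  match i with
  | IdxLam n => isoSub Q (@LamSub K n)
  | IdxSchur la => isoSub Q (@SchurBarSub K (sumn la) la)
  end.

(* Main.v *)
Require Import Defs.
From HB Require Import structures.
From mathcomp Require Import all_boot all_order all_algebra all_fingroup.
From mathcomp Require Import freeg.
Set Implicit Arguments. Unset Strict Implicit. Unset Printing Implicit Defensive.
Import GRing.Theory.

(** Write KFA(a,b) for the space with basis the maps a -> b, so that P_n = KFA(n,-) and
    natural maps P_n -> P_k are multiplications by elements of KFA(k,n). Each listed functor
    is e KFA(n,-) for an idempotent e of KFA(n,n):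
    - e = c / n! for the exterior powers of P, where c is the antisymmetrizer;
    - e = c d / alpha for S_la(Pbar), where c is the Young symmetrizer, c^2 = alpha c, and
      d = -1/2 (x_1 - x_0)^2 (x_2 - x_0) ... (x_{n-1} - x_0).
    A tensor in Pbar^n is killed by every non-surjective map, so an element of KFA(n,n) acts on
    it through its permutation part; the permutation part of d is (1 + (0 1))/2, which the row
    symmetrizer absorbs as soon as the first row of la has length at least 2.
    The classical identities for Young symmetrizers then give e KFA(n,n) e = K e, the vanishing
    of e KFA e' KFA e for distinct e, e', and (by induction on n, non-injective maps factoring
    through n - 1) that 1 lies in the ideal generated by the idempotents e.
    These three facts give the theorem: a projective Q has a dual basis with respect to a free
    cover, whose maps can be made to factor through listed functors; if no composite
    e -> Q -> e is invertible, Gaussian elimination shows Q = 0. *)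

(** * Tableaux *)

Section Boxes.
Implicit Types (la mu : seq nat) (i j r c k : nat).

Lemma rowOf_cons x la i :
  rowOf (x :: la) i = if x <= i then (rowOf la (i - x)).+1 else 0.
Proof.
rewrite /rowOf /= take0 /= addn0; case: (leqP x i) => [xi|xi] /=.
  rewrite add1n; congr _.+1; rewrite (iotaDl 1) count_map; apply: eq_count => r /=.
  by rewrite leq_subRL.
rewrite add0n; apply/eqP; rewrite -leqn0 leqNgt -has_count -all_predC.
apply/allP=> r _ /=; rewrite -ltnNge (leq_trans xi) //; case: r => [|r] /=; exact: leq_addr.
Qed.

Lemma colOf_cons x la i :
  colOf (x :: la) i = if x <= i then colOf la (i - x) else i.
Proof.
rewrite /colOf rowOf_cons; case: (leqP x i) => xi /=; first by rewrite subnDA.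
by rewrite subn0.
Qed.

(** Boxes are numbered row by row, so the first rows form an initial segment; this converts counts
    of boxes into partial sums. *)
Lemma rowOf_lt la i k : i < sumn la -> (rowOf la i < k) = (i < sumn (take k la)).
Proof.
elim: la i k => // x la IHla i [|k] //= ix; rewrite rowOf_cons.
case: (leqP x i) => xi; last by rewrite (leq_trans xi) // leq_addr.
by rewrite ltnS IHla ?ltn_subLR.
Qed.

(** The default 0 makes every row past the end empty, so [r] needs no bound. *)
Definition box la r c := c < nth 0 la r.
Definition boxpos la r c := sumn (take r la) + c.

Lemma box_rowcol la i : i < sumn la -> box la (rowOf la i) (colOf la i).
Proof.
rewrite /box; elim: la i => // x la IHla i /= ix; rewrite rowOf_cons colOf_cons.
by case: (leqP x i) => xi //=; apply: IHla; rewrite ltn_subLR.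
Qed.

Lemma boxposK la i : boxpos la (rowOf la i) (colOf la i) = i.
Proof.
rewrite /boxpos; elim: la i => [|x la IHla] i /=; first by rewrite /colOf subn0.
rewrite rowOf_cons colOf_cons; case: (leqP x i) => xi //=.
by rewrite -addnA IHla subnKC.
Qed.

Lemma boxposP la r c : box la r c ->
  [/\ boxpos la r c < sumn la, rowOf la (boxpos la r c) = r & colOf la (boxpos la r c) = c].
Proof.
rewrite /box /boxpos; elim: la r => [|x la IHla] [|r] //= cx.
  have xc : (x <= c) = false by rewrite leqNgt cx.
  by rewrite add0n rowOf_cons colOf_cons xc (leq_trans cx (leq_addr _ _)).
have [lt rE cE] := IHla r cx.
by rewrite -addnA ltn_add2l lt rowOf_cons colOf_cons leq_addr addKn rE cE.
Qed.

Lemma box_up la r r' c : is_partition la -> r' <= r -> box la r c -> box la r' c.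
Proof.
case/andP=> la_sorted _; rewrite /box => rr' cr; apply: leq_trans cr _.
have [rs|rs] := ltnP r (size la); last by rewrite nth_default.
apply: (sorted_leq_nth (leT := geq)) => //; last exact: leq_ltn_trans rs.
  by move=> x y z xy zx; apply: leq_trans zx xy.
exact: leqnn.
Qed.

(** Parts are differences of consecutive partial sums, and positivity of the parts recovers the
    length. *)
Lemma partition_inj la mu : is_partition la -> is_partition mu ->
  (forall k, sumn (take k la) = sumn (take k mu)) -> la = mu.
Proof.
have nthE s k : nth 0 s k = sumn (take k.+1 s) - sumn (take k s).
  have [ks|ks] := ltnP k (size s); first by rewrite (take_nth 0) // sumn_rcons addKn.
  by rewrite !take_oversize ?(leq_trans ks) // subnn nth_default.
have sizeE s k : is_partition s -> (k < size s) = (0 < nth 0 s k).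
  case/andP=> _ /all_nthP s0; case: (ltnP k (size s)) => [/(s0 0)->//|ks].
  by rewrite nth_default.
move=> la_p mu_p lamu.
have nE k : nth 0 la k = nth 0 mu k by rewrite !nthE !lamu.
have szE : size la = size mu.
  apply/eqP; rewrite eqn_leq; apply/andP; split; rewrite leqNgt.
    by rewrite sizeE // nE nth_default.
  by rewrite sizeE // -nE nth_default.
exact: (@eq_from_nth _ 0).
Qed.

End Boxes.

(** * Dominance, and factorization into row and column permutations *)

Section Tableaux.
Variables (n : nat) (la mu : seq nat) (h : 'S_n).
Hypotheses (la_n : sumn la = n) (mu_n : sumn mu = n) (mu_part : is_partition mu).
Hypothesis rows_split : forall i j : 'I_n, i != j -> rowOf la i = rowOf la j ->
  colOf mu (h i) <> colOf mu (h j).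

Let A k c := [set i : 'I_n | (rowOf la i < k) && (colOf mu (h i) == c)].
Let B k c := [set j : 'I_n | (rowOf mu j < k) && (colOf mu j == c)].

(** If column [c] of [mu] reaches row [k.-1], moving a box of [A k c] to the same row of column [c]
    is injective, as each row of [la] sends at most one box there. Otherwise [B k c] is the whole
    column and [h] itself is the injection. *)
Lemma card_rows_col_le k c : #|A k c| <= #|B k c|.
Proof.
have [bx|nbx] := boolP (box mu k.-1 c); last first.
  rewrite -(card_imset (A k c) (@perm_inj _ h)); apply: subset_leq_card.
  apply/subsetP=> _ /imsetP[i /[!inE] /andP[ik /eqP ic] ->]; rewrite ic eqxx andbT ltnNge.
  apply: contra nbx => kh; have : box mu (rowOf mu (h i)) c.
    by rewrite -ic; apply: box_rowcol; rewrite mu_n.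
  by apply: box_up => //; apply: leq_trans kh; apply: leq_pred.
have bxi i : i \in A k c -> box mu (rowOf la i) c.
  rewrite inE => /andP[ik _]; apply: box_up bx => //.
  by rewrite -ltnS prednK // (leq_ltn_trans _ ik).
(* The default [i] is never met on [A k c], where the target box exists. *)
pose f (i : 'I_n) : 'I_n := insubd i (boxpos mu (rowOf la i) c).
have fP i : i \in A k c -> rowOf mu (f i) = rowOf la i /\ colOf mu (f i) = c.
  by move=> /bxi/boxposP[]; rewrite mu_n => lt rE cE; rewrite val_insubd lt rE cE.
have f_inj : {in A k c &, injective f}.
  move=> i j iA jA fij; apply/eqP/negP=> /negP ij.
  apply: (rows_split ij); first by rewrite -(fP _ iA).1 -(fP _ jA).1 fij.
  by move: iA jA; rewrite !inE => /andP[_ /eqP->] /andP[_ /eqP->].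
rewrite -(card_in_imset f_inj); apply: subset_leq_card.
apply/subsetP=> _ /imsetP[i iA ->]; have [rE cE] := fP i iA.
by rewrite inE rE cE eqxx andbT; move: iA; rewrite inE => /andP[].
Qed.

Let colO (i : 'I_n) : 'I_n := Ordinal (leq_ltn_trans (leq_subr _ _) (ltn_ord i) : colOf mu i < n).

Lemma card_rows la' k : sumn la' = n -> #|[set i : 'I_n | rowOf la' i < k]| = sumn (take k la').
Proof.
move=> la'n; have le : sumn (take k la') <= n.
  by rewrite -la'n -{2}(cat_take_drop k la') sumn_cat leq_addr.
rewrite -sum1_card -[RHS]card_ord -[RHS]sum1_card (big_ord_widen n (fun _ => 1)) //.
by apply: eq_bigl => i; rewrite inE rowOf_lt ?la'n.
Qed.

Lemma sum_card_A k : \sum_(c < n) #|A k c| = sumn (take k la).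
Proof.
rewrite -card_rows // -[RHS]sum1_card [RHS](partition_big (fun i => colO (h i)) xpredT) //=.
apply: eq_bigr => c _; rewrite -sum1_card; apply: eq_bigl => i.
by rewrite !inE -val_eqE.
Qed.

Lemma sum_card_B k : \sum_(c < n) #|B k c| = sumn (take k mu).
Proof.
rewrite -(card_rows k mu_n) -[RHS]sum1_card [RHS](partition_big colO xpredT) //=.
apply: eq_bigr => c _; rewrite -sum1_card; apply: eq_bigl => i.
by rewrite !inE -val_eqE.
Qed.

Lemma rows_split_dominance k : sumn (take k la) <= sumn (take k mu).
Proof. by rewrite -sum_card_A -sum_card_B; apply: leq_sum => c _; apply: card_rows_col_le. Qed.

(** For equal shapes the inequalities of [card_rows_col_le] sum to an equality, so each is one.
    Adding the row of [i] enlarges [A] in the column of [h i], hence also [B]: that column reaches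
    this row. *)
Lemma rows_split_box (i : 'I_n) : la = mu -> box mu (rowOf la i) (colOf mu (h i)).
Proof.
move=> lamu; have AB k (c : 'I_n) : #|A k c| = #|B k c|.
  apply/eqP; rewrite eqn_leq card_rows_col_le /= -(leq_add2r (\sum_(d < n | d != c) #|A k d|)).
  have -> : #|A k c| + \sum_(d < n | d != c) #|A k d| = \sum_(d < n) #|A k d| by rewrite [RHS](bigD1 c).
  rewrite sum_card_A lamu -sum_card_B.
  rewrite [X in _ <= X](bigD1 c) //= leq_add2l; apply: leq_sum => d _; exact: card_rows_col_le.
set k := rowOf la i; pose c := colO (h i).
have : #|A k c| < #|A k.+1 c|.
  apply: proper_card; apply/properP; split.
    by apply/subsetP=> j; rewrite !inE => /andP[jk ->]; rewrite ltnW.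
  by exists i; rewrite !inE eqxx ?ltnn // leqnn.
rewrite !AB ltnNge; apply: contraR => nbx; apply: subset_leq_card.
apply/subsetP=> j; rewrite !inE => /andP[jk /eqP jc]; rewrite jc eqxx andbT.
move: jk; rewrite ltnS leq_eqVlt => /predU1P[jk|//].
case/negP: nbx; rewrite -jk -[colOf mu (h i)]/(nat_of_ord c) -jc.
by apply: box_rowcol; rewrite mu_n.
Qed.

End Tableaux.

(** The factor [p] moves each [i] along its row to the column of [h i], a box that exists by
    [rows_split_box]; the rest of [h] preserves columns. *)
Lemma rows_split_factor n la (h : 'S_n) : sumn la = n -> is_partition la ->
  (forall i j : 'I_n, i != j -> rowOf la i = rowOf la j ->
     colOf la (h i) <> colOf la (h j)) ->
  exists p q, [/\ p \in rowGroup n la, q \in colGroup n la & h = (p * q)%g].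
Proof.
move=> la_n la_p H.
have bx (i : 'I_n) := rows_split_box la_n la_n la_p H i erefl.
pose f (i : 'I_n) : 'I_n := insubd i (boxpos la (rowOf la i) (colOf la (h i))).
have fP i : rowOf la (f i) = rowOf la i /\ colOf la (f i) = colOf la (h i).
  by have [] := boxposP (bx i); rewrite la_n => lt rE cE; rewrite val_insubd lt rE cE.
have f_inj : injective f.
  move=> i j fij; apply/eqP/negP=> /negP ij.
  apply: (H _ _ ij); first by rewrite -(fP i).1 -(fP j).1 fij.
  by rewrite -(fP i).2 -(fP j).2 fij.
exists (perm f_inj), ((perm f_inj)^-1 * h)%g; split.
- by rewrite inE; apply/forallP=> i; rewrite permE (fP i).1.
- rewrite inE; apply/forallP=> j; rewrite permM.
  by rewrite -{2}[j](permKV (perm f_inj)) permE (fP _).2.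
by rewrite mulKVg.
Qed.

Local Open Scope ring_scope.

(** * The linearization of FA *)

Section LinearCategory.
Variable K : fieldType.

Definition dl a b (f : {ffun 'I_a -> 'I_b}) : Pn K a b := [ffun h => (h == f)%:R].

(* Composition in diagrammatic order: [pm] below then turns products of permutations in the sense
   of fingroup into products of this algebra. *)
Definition cmul a b c (u : Pn K a b) (v : Pn K b c) : Pn K a c :=
  \sum_f \sum_g (u f * v g) *: dl (compf f g).

Lemma dl_sum a b (v : Pn K a b) : v = \sum_f v f *: dl f.
Proof.
apply/ffunP=> h; rewrite sum_ffunE (bigD1 h) //= big1 => [|f /negPf fh].
  by rewrite addr0 !ffunE eqxx; apply/esym/mulr1.
by rewrite !ffunE eq_sym fh; apply: mulr0.
Qed.

Lemma cmulDl a b c (u v : Pn K a b) (w : Pn K b c) :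
  cmul (u + v) w = cmul u w + cmul v w.
Proof.
rewrite -big_split; apply: eq_bigr => f _; rewrite -big_split; apply: eq_bigr => g _.
by rewrite ffunE mulrDl scalerDl.
Qed.

Lemma cmulDr a b c (w : Pn K a b) (u v : Pn K b c) :
  cmul w (u + v) = cmul w u + cmul w v.
Proof.
rewrite -big_split; apply: eq_bigr => f _; rewrite -big_split; apply: eq_bigr => g _.
by rewrite ffunE mulrDr scalerDl.
Qed.

Lemma cmulZl a b c k (u : Pn K a b) (w : Pn K b c) : cmul (k *: u) w = k *: cmul u w.
Proof.
rewrite scaler_sumr; apply: eq_bigr => f _; rewrite scaler_sumr; apply: eq_bigr => g _.
by rewrite ffunE scalerA mulrA.
Qed.

Lemma cmulZr a b c k (w : Pn K a b) (u : Pn K b c) : cmul w (k *: u) = k *: cmul w u.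
Proof.
rewrite scaler_sumr; apply: eq_bigr => f _; rewrite scaler_sumr; apply: eq_bigr => g _.
by rewrite ffunE scalerA; congr (_ *: _); apply: mulrCA.
Qed.

Lemma cmul0l a b c (w : Pn K b c) : cmul (0 : Pn K a b) w = 0.
Proof. by rewrite -(scale0r 0) cmulZl scale0r. Qed.

Lemma cmul0r a b c (w : Pn K a b) : cmul w (0 : Pn K b c) = 0.
Proof. by rewrite -(scale0r 0) cmulZr scale0r. Qed.

Lemma cmulNl a b c (u : Pn K a b) (w : Pn K b c) : cmul (- u) w = - cmul u w.
Proof. by rewrite -scaleN1r cmulZl scaleN1r. Qed.

Lemma cmulNr a b c (w : Pn K a b) (u : Pn K b c) : cmul w (- u) = - cmul w u.
Proof. by rewrite -scaleN1r cmulZr scaleN1r. Qed.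

Lemma cmul_suml a b c I (r : seq I) (Q : pred I) (F : I -> Pn K a b) (w : Pn K b c) :
  cmul (\sum_(i <- r | Q i) F i) w = \sum_(i <- r | Q i) cmul (F i) w.
Proof. by apply: (big_morph (fun u => cmul u w)) => [u v|]; rewrite ?cmulDl ?cmul0l. Qed.

Lemma cmul_sumr a b c I (r : seq I) (Q : pred I) (w : Pn K a b) (F : I -> Pn K b c) :
  cmul w (\sum_(i <- r | Q i) F i) = \sum_(i <- r | Q i) cmul w (F i).
Proof. by apply: (big_morph (cmul w)) => [u v|]; rewrite ?cmulDr ?cmul0r. Qed.

Lemma cmul_dl a b c (f : {ffun 'I_a -> 'I_b}) (g : {ffun 'I_b -> 'I_c}) :
  cmul (dl f) (dl g) = dl (compf f g).
Proof.
rewrite /cmul (bigD1 f) //= (bigD1 g) //= !ffunE !eqxx mulr1 scale1r.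
rewrite big1 ?addr0 => [|g' /negPf gg']; last by rewrite !ffunE gg' mulr0 scale0r.
rewrite big1 ?addr0 // => f' /negPf ff'.
by rewrite big1 // => g' _; rewrite !ffunE ff' mul0r scale0r.
Qed.

Lemma cmul_dlE a b c (u : Pn K a b) (v : Pn K b c) : cmul u v = \sum_f u f *: cmul (dl f) v.
Proof. by rewrite {1}[u]dl_sum cmul_suml; apply: eq_bigr => f _; rewrite cmulZl. Qed.

Lemma cmul_dlEr a b c (u : Pn K a b) (v : Pn K b c) : cmul u v = \sum_g v g *: cmul u (dl g).
Proof. by rewrite {1}[v]dl_sum cmul_sumr; apply: eq_bigr => f _; rewrite cmulZr. Qed.

Lemma cmulA a b c d (u : Pn K a b) (v : Pn K b c) (w : Pn K c d) :
  cmul u (cmul v w) = cmul (cmul u v) w.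
Proof.
rewrite cmul_dlE [cmul u v]cmul_dlE cmul_suml; apply: eq_bigr => f _; rewrite cmulZl.
congr (_ *: _); rewrite [cmul v w]cmul_dlE [cmul _ v]cmul_dlEr cmul_sumr cmul_suml.
apply: eq_bigr => g _; rewrite cmulZl cmulZr; congr (_ *: _).
rewrite [cmul (dl g) w]cmul_dlEr [RHS]cmul_dlEr cmul_sumr; apply: eq_bigr => h _.
rewrite cmulZr !cmul_dl; congr (_ *: dl _).
by apply/ffunP=> i; rewrite !ffunE.
Qed.

Lemma comp1f a b (f : {ffun 'I_a -> 'I_b}) : compf (idf a) f = f.
Proof. by apply/ffunP=> i; rewrite !ffunE. Qed.

Lemma compf1 a b (f : {ffun 'I_a -> 'I_b}) : compf f (idf b) = f.
Proof. by apply/ffunP=> i; rewrite !ffunE. Qed.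

Lemma cmul1l a b (u : Pn K a b) : cmul (dl (idf a)) u = u.
Proof.
by rewrite cmul_dlEr [RHS]dl_sum; apply: eq_bigr => f _; rewrite cmul_dl comp1f.
Qed.

Lemma cmul1r a b (u : Pn K a b) : cmul u (dl (idf b)) = u.
Proof.
by rewrite cmul_dlE [RHS]dl_sum; apply: eq_bigr => f _; rewrite cmul_dl compf1.
Qed.

(** With [permPnE], this moves the problem into the algebra: functoriality multiplies on the right,
    place permutation on the left. *)
Lemma pushPnE n m m' (f : {ffun 'I_m -> 'I_m'}) (v : Pn K n m) :
  pushPn f v = cmul v (dl f).
Proof.
rewrite cmul_dlE; apply/ffunP=> h; rewrite sum_ffunE ffunE [RHS](bigID (fun g => compf g f == h)) /=.
rewrite [X in _ = _ + X]big1 ?addr0 => [|g /negPf gf].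
  by apply: eq_bigr => g /eqP<-; rewrite cmul_dl !ffunE eqxx; apply/esym/mulr1.
by rewrite cmul_dl !ffunE eq_sym gf; apply: mulr0.
Qed.

Definition pf n (s : 'S_n) : {ffun 'I_n -> 'I_n} := [ffun i => s i].
Definition pm n (s : 'S_n) : Pn K n n := dl (pf s).

Lemma pf_inj n : injective (@pf n).
Proof. by move=> s t /ffunP st; apply/permP=> i; have := st i; rewrite !ffunE. Qed.

Lemma pfM n (s t : 'S_n) : compf (pf s) (pf t) = pf (s * t)%g.
Proof. by apply/ffunP=> i; rewrite !ffunE permM. Qed.

Lemma pf1 n : pf (1%g : 'S_n) = idf n.
Proof. by apply/ffunP=> i; rewrite !ffunE perm1. Qed.

Lemma pmM n (s t : 'S_n) : cmul (pm s) (pm t) = pm (s * t)%g.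
Proof. by rewrite cmul_dl pfM. Qed.

Lemma permPnE n m (s : 'S_n) (v : Pn K n m) : permPn s v = cmul (pm s) v.
Proof.
rewrite cmul_dlEr; apply/ffunP=> h; rewrite sum_ffunE ffunE.
set h' := [ffun i => _]; have hh' : compf (pf s) h' = h.
  by apply/ffunP=> i; rewrite !ffunE permK.
rewrite (bigD1 h') //= big1 ?addr0 => [|g /negPf gh].
  by rewrite cmul_dl hh' !ffunE eqxx; apply/esym/mulr1.
rewrite cmul_dl !ffunE; case: eqP => [hE|_]; last exact: mulr0.
move/eqP: gh => []; apply/ffunP=> i; rewrite !ffunE hE !ffunE.
by rewrite permKV.
Qed.

End LinearCategory.
Arguments cmul {K a b c}.
Arguments dl {K a b}.
Arguments pm {K n}.

(** * Natural maps from and to the functors P_n *)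

Section Evaluation.
Variables (K : fieldType) (Q : FAmod K).

Lemma factD m n (f : {ffun 'I_m -> 'I_n}) : {morph fact Q f : x y / x + y}.
Proof. by move=> x y; rewrite -[x]scale1r fact_lin !scale1r. Qed.

Lemma fact0 m n (f : {ffun 'I_m -> 'I_n}) : fact Q f 0 = 0.
Proof. by apply: (addrI (fact Q f 0)); rewrite -factD !addr0. Qed.

Lemma factZ m n (f : {ffun 'I_m -> 'I_n}) k x : fact Q f (k *: x) = k *: fact Q f x.
Proof. by rewrite -[k *: x]addr0 fact_lin fact0 addr0. Qed.

Lemma fact_sum m n (f : {ffun 'I_m -> 'I_n}) I (r : seq I) (P : pred I) F :
  fact Q f (\sum_(i <- r | P i) F i) = \sum_(i <- r | P i) fact Q f (F i).
Proof. exact: (big_morph _ (factD f) (fact0 f)). Qed.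

(** The Yoneda map P_n -> Q that sends the identity to [x]. *)
Definition ev n (x : fobj Q n) m (v : Pn K n m) : fobj Q m := \sum_g v g *: fact Q g x.

Lemma ev_lin n (x : fobj Q n) m k (u v : Pn K n m) : ev x (k *: u + v) = k *: ev x u + ev x v.
Proof.
rewrite /ev scaler_sumr -big_split; apply: eq_bigr => g _.
by rewrite !ffunE scalerDl scalerA.
Qed.

Lemma evD n (x : fobj Q n) m : {morph @ev n x m : u v / u + v}.
Proof. by move=> u v; rewrite -[u]scale1r ev_lin !scale1r. Qed.

Lemma ev0 n (x : fobj Q n) m : ev x (0 : Pn K n m) = 0.
Proof. by apply: (addrI (ev x 0)); rewrite -evD !addr0. Qed.

Lemma evZ n (x : fobj Q n) m k (u : Pn K n m) : ev x (k *: u) = k *: ev x u.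
Proof. by rewrite -[k *: u]addr0 ev_lin ev0 addr0. Qed.

Lemma ev_sum n (x : fobj Q n) m I (r : seq I) (P : pred I) (F : I -> Pn K n m) :
  ev x (\sum_(i <- r | P i) F i) = \sum_(i <- r | P i) ev x (F i).
Proof. exact: (big_morph _ (evD x (m := m)) (ev0 x m)). Qed.

Lemma ev_dl n (x : fobj Q n) m (g : {ffun 'I_n -> 'I_m}) : ev x (dl g) = fact Q g x.
Proof.
rewrite /ev (bigD1 g) //= ffunE eqxx scale1r big1 ?addr0 // => h /negPf hg.
by rewrite ffunE hg scale0r.
Qed.

Lemma ev1 n (x : fobj Q n) : ev x (dl (idf n)) = x.
Proof. by rewrite ev_dl fact_id. Qed.

Lemma fact_ev n (x : fobj Q n) m m' (f : {ffun 'I_m -> 'I_m'}) v :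
  fact Q f (ev x v) = ev x (cmul v (dl f)).
Proof.
rewrite cmul_dlE ev_sum fact_sum; apply: eq_bigr => g _.
by rewrite factZ evZ cmul_dl ev_dl fact_comp.
Qed.

Lemma ev_ev n (x : fobj Q n) m (v : Pn K n m) p (w : Pn K m p) :
  ev (ev x v) w = ev x (cmul v w).
Proof.
rewrite [cmul v w]cmul_dlEr ev_sum; apply: eq_bigr => g _.
by rewrite evZ fact_ev.
Qed.

Lemma evDl n (x y : fobj Q n) m (v : Pn K n m) : ev (x + y) v = ev x v + ev y v.
Proof. by rewrite -big_split; apply: eq_bigr => g _; rewrite factD scalerDr. Qed.

Lemma evZl n k (x : fobj Q n) m (v : Pn K n m) : ev (k *: x) v = k *: ev x v.
Proof.
rewrite scaler_sumr; apply: eq_bigr => g _.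
by rewrite factZ !scalerA mulrC.
Qed.

Definition natP n (phi : forall m, fobj Q m -> Pn K n m) :=
  (forall m k x y, phi m (k *: x + y) = k *: phi m x + phi m y) /\
  (forall m m' (f : {ffun 'I_m -> 'I_m'}) q, phi m' (fact Q f q) = cmul (phi m q) (dl f)).

Section NatP.
Variables (n : nat) (phi : forall m, fobj Q m -> Pn K n m).
Arguments phi : clear implicits.
Hypothesis phiP : natP phi.

Lemma natPD m : {morph phi m : x y / x + y}.
Proof. by move=> x y; rewrite -[x]scale1r phiP.1 !scale1r. Qed.

Lemma natP0 m : phi m 0 = 0.
Proof. by apply: (addrI (phi m 0)); rewrite -natPD !addr0. Qed.

Lemma natPZ m k x : phi m (k *: x) = k *: phi m x.
Proof. by rewrite -[k *: x]addr0 phiP.1 natP0 addr0. Qed.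

Lemma natP_sum m I (r : seq I) (P : pred I) (F : I -> fobj Q m) :
  phi m (\sum_(i <- r | P i) F i) = \sum_(i <- r | P i) phi m (F i).
Proof. exact: (big_morph _ (@natPD m) (@natP0 m)). Qed.

Lemma natP_ev p (x : fobj Q p) m (v : Pn K p m) : phi m (ev x v) = cmul (phi p x) v.
Proof.
rewrite natP_sum cmul_dlEr; apply: eq_bigr => g _.
by rewrite natPZ phiP.2.
Qed.

End NatP.

Lemma ev_subfun n (x : fobj Q n) A m (v : Pn K n m) :
  is_subfun A -> A n x -> A m (ev x v).
Proof.
case=> [A0 [Alin Afact]] Ax; apply: (big_ind (A m)) => // [y z Ay Az|g _].
  by rewrite -[y]scale1r; apply: Alin.
by rewrite -[_ *: _]addr0; apply: Alin => //; apply: Afact.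
Qed.

(* [Q] is isomorphic to the functor e KFA(n,-), where e : KFA(n,n) is an idempotent. *)
Definition retract n (e : Pn K n n) := exists (x : fobj Q n) (phi : forall m, fobj Q m -> Pn K n m),
  [/\ natP phi, forall m q, ev x (phi m q) = q & phi n x = e].

End Evaluation.

(** A non-zero idempotent with corner ring K: the functor e KFA(n,-) has only scalar
    endomorphisms. *)
Definition cornerK (K : fieldType) n (e : Pn K n n) :=
  [/\ e <> 0, cmul e e = e & forall z, exists k, cmul e (cmul z e) = k *: e].

(** * Properties of the functors e KFA(n,-) *)

Section Retract.
Variable K : fieldType.

Lemma isoSub_retract (Q : FAmod K) n (e : Pn K n n) (S : forall m, Pn K n m -> Prop) :
  cmul e e = e -> (forall m x, S m x <-> cmul e x = x) -> isoSub Q S <-> retract Q e.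
Proof.
move=> ee SE; split=> [[phi [phi_lin [phi_inj [phiS phi_nat]]]]|[x [phi [phiP phiK phix]]]].
  have phiP : natP phi by split=> // m m' f q; rewrite phi_nat pushPnE.
  have [x phix] : exists x, phi n x = e by apply/phiS/SE.
  exists x, phi; split=> // m q; apply: phi_inj; rewrite (natP_ev phiP) phix.
  by apply/SE/phiS; exists q.
exists phi; split; first exact: phiP.1.
split; first by move=> m; apply: (can_inj (phiK m)).
split=> [m y|m m' f q]; last by rewrite phiP.2 pushPnE.
split=> [/SE ey|[q <-]].
  by exists (ev x y); rewrite (natP_ev phiP) phix.
by apply/SE; rewrite -{2}(phiK _ q) (natP_ev phiP) phix.
Qed.

Lemma retract_projective (Q : FAmod K) n (e : Pn K n n) : retract Q e -> projective Q.
Proof.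
move=> [x [phi [phiP phiK _]]] M N pi g [pi_lin pi_nat] pi_surj [g_lin g_nat].
have piD m : {morph pi m : u v / u + v} by move=> u v; rewrite -[u]scale1r pi_lin !scale1r.
have pi0 m : pi m 0 = 0 by apply: (addrI (pi m 0)); rewrite -piD !addr0.
have gD m : {morph g m : u v / u + v} by move=> u v; rewrite -[u]scale1r g_lin !scale1r.
have g0 m : g m 0 = 0 by apply: (addrI (g m 0)); rewrite -gD !addr0.
(* By Yoneda it suffices to lift the image of the generator [x]. *)
have [y piy] := pi_surj n (g n x).
exists (fun m q => ev y (phi m q)); split; first split=> [m k u v|m p f u].
- by rewrite phiP.1 ev_lin.
- by rewrite phiP.2 fact_ev.
move=> m q; rewrite -{2}(phiK m q) /ev (big_morph _ (@piD m) (@pi0 m)).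
rewrite (big_morph _ (@gD m) (@g0 m)); apply: eq_bigr => h _.
rewrite -[_ *: fact M _ _]addr0 pi_lin pi0 -[_ *: fact Q _ _]addr0 g_lin g0.
by rewrite pi_nat g_nat piy.
Qed.

(** Split the generator as [x = a + b]; the endomorphism q -> [ev a (phi q)] is a scalar [k]. If [k]
    is 0, every q is [ev b (phi q)], in [B]; otherwise every q is a multiple of [ev a (phi q)], in
    [A]. *)
Lemma retract_indecomposable (Q : FAmod K) n (e : Pn K n n) :
  cornerK e -> retract Q e -> indecomposable Q.
Proof.
move=> [e0 ee eK] [x [phi [phiP phiK phix]]]; split.
  by exists n, x => x0; apply: e0; rewrite -phix x0 (natP0 phiP).
move=> A B Asub Bsub AB0 ABT; have [a [b [Aa [Bb xE]]]] := ABT n x.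
have [k phiak] := eK (phi n a).
have pab m q : q = ev a (phi m q) + ev b (phi m q) by rewrite -evDl -xE phiK.
have evxphi m q : cmul e (phi m q) = phi m q.
  by rewrite -{2}(phiK m q) (natP_ev phiP) phix.
have pak m q : ev a (phi m q) = k *: q.
  rewrite -[LHS]phiK (natP_ev phiP) -evxphi -[phi m q]evxphi !cmulA -(cmulA e).
  by rewrite phiak cmulZl evxphi evZ phiK.
have [k0|k0] := eqVneq k 0.
  left=> m q Aq; apply: AB0 => //; rewrite (pab m q) pak k0 scale0r add0r.
  exact: ev_subfun.
right=> m q Bq; apply: AB0 => //; rewrite -[q](scalerK k0) -pak.
have [A0 [Alin _]] := Asub.
by rewrite -[_ *: _]addr0; apply: Alin => //; apply: ev_subfun.
Qed.

(** Passing through [Q] gives mutually inverse isomorphisms between the two functors. Hence they are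
    not isomorphic as soon as all composites e -> e' -> e vanish and [e] is not 0. *)
Lemma retract_factor (Q : FAmod K) n (e : Pn K n n) n' (e' : Pn K n' n') :
  retract Q e -> retract Q e' ->
  exists x y, cmul (cmul e (cmul x e')) (cmul e' (cmul y e)) = e.
Proof.
move=> [x [phi [phiP phiK phix]]] [x' [phi' [phiP' phiK' phix']]].
have ee m q : cmul e (phi m q) = phi m q by rewrite -{2}(phiK m q) (natP_ev phiP) phix.
have ee' m q : cmul e' (phi' m q) = phi' m q by rewrite -{2}(phiK' m q) (natP_ev phiP') phix'.
exists (phi n' x'), (phi' n x).
have -> : cmul (phi n' x') e' = phi n' x' by rewrite -phix' -(natP_ev phiP) phiK'.
have -> : cmul (phi' n x) e = phi' n x by rewrite -phix -(natP_ev phiP') phiK.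
by rewrite ee ee' -(natP_ev phiP) phiK'.
Qed.

End Retract.

(** * Construction of e KFA(n,-) *)

Section RetractFunctor.
Variables (K : fieldType) (n : nat) (e : Pn K n n).

(** The image of an idempotent is written as a kernel, which is a [vspace] and so carries a module
    structure. *)
Definition defect m (x : Pn K n m) : Pn K n m := cmul e x - x.

Fact defect_linear m : linear (@defect m).
Proof. by move=> k u v; rewrite /defect cmulDr cmulZr scalerBr opprD addrACA. Qed.

HB.instance Definition _ m := GRing.isLinear.Build K (Pn K n m) (Pn K n m) _
  (@defect m) (@defect_linear m).

Definition fixedBy m : {vspace Pn K n m} := lker (linfun (@defect m)).

Lemma fixedByP m (x : Pn K n m) : reflect (cmul e x = x) (x \in fixedBy m).
Proof. by rewrite memv_ker lfunE /= subr_eq0; apply: eqP. Qed.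

Fact fixedBy_push m m' (f : {ffun 'I_m -> 'I_m'}) (x : subvs_of (fixedBy m)) :
  cmul (vsval x) (dl f) \in fixedBy m'.
Proof. by apply/fixedByP; rewrite cmulA; have /fixedByP-> := subvsP x. Qed.

Definition fixedMod : FAmod K.
Proof.
refine {| fobj := fun m => subvs_of (fixedBy m);
  fact := fun m m' f x => Subvs (fixedBy_push f x) |}.
- by move=> m m' f k x y; apply: val_inj; rewrite /= cmulDl cmulZl.
- by move=> m x; apply: val_inj; rewrite /= cmul1r.
- by move=> m m' p f g x; apply: val_inj; rewrite /= -cmulA cmul_dl.
Defined.

Lemma fixedMod_retract : cmul e e = e -> retract fixedMod e.
Proof.
move=> ee; have /fixedByP eF := ee.
exists (Subvs eF), (fun m x => vsval x); split=> // m q; apply: val_inj => /=.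
rewrite /ev /= raddf_sum /= -[RHS](fixedByP _ (subvsP q)) cmul_dlEr.
by apply: eq_bigr => g _.
Qed.

End RetractFunctor.

(** * Projective functors *)

Section FreeCover.
Variables (K : fieldType) (Q : FAmod K).

(** A basis at [k] of the direct sum of one P_m for each [m] and each element of [Q] at [m]: the
    element names the summand, the map names the basis vector in it. *)
Definition gen k : choiceType := {m : nat & (fobj Q m * {ffun 'I_m -> 'I_k})%type}.
Definition mkgen k m (x : fobj Q m) (g : {ffun 'I_m -> 'I_k}) : gen k :=
  existT (fun m => (fobj Q m * {ffun 'I_m -> 'I_k})%type) m (x, g).
Definition genmap k k' (f : {ffun 'I_k -> 'I_k'}) (t : gen k) : gen k' :=
  mkgen (tagged t).1 (compf (tagged t).2 f).
Definition genval k (t : gen k) : fobj Q k := fact Q (tagged t).2 (tagged t).1.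

Section Lift.
Variables (T : choiceType) (M : lmodType K) (f : T -> M).

Lemma fglift_lin k (D E : {freeg T / K}) :
  fglift f (k *: D + E) = k *: fglift f D + fglift f E.
Proof.
have fB := lift_is_additive f.
have f0 : fglift f 0 = 0 by rewrite -(subrr 0) fB subrr.
have fN D1 : fglift f (- D1) = - fglift f D1 by rewrite -sub0r fB f0 sub0r.
have fD D1 D2 : fglift f (D1 + D2) = fglift f D1 + fglift f D2.
  by rewrite -{1}[D2]opprK fB fN opprK.
rewrite fD; congr (_ + _); rewrite -{2}[D]freeg_sumE.
rewrite !(big_morph (fglift f) fD f0) scaler_sumr; apply: eq_bigr => z _.
by rewrite !liftU scalerA.
Qed.

Lemma fgliftD : {morph fglift f : D E / D + E}.
Proof. by move=> D E; rewrite -[D]scale1r fglift_lin !scale1r. Qed.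

Lemma fglift0 : fglift f 0 = 0.
Proof. by apply: (addrI (fglift f 0)); rewrite -fgliftD !addr0. Qed.

Lemma fglift_sum J (r : seq J) (F : J -> {freeg T / K}) :
  fglift f (\sum_(j <- r) F j) = \sum_(j <- r) fglift f (F j).
Proof. exact: (big_morph _ fgliftD fglift0). Qed.

Lemma fgliftE (D : {freeg T / K}) : fglift f D = \sum_(z <- dom D) coeff z D *: f z.
Proof. by rewrite -{1}[D]freeg_sumE fglift_sum; apply: eq_bigr => z _; rewrite liftU. Qed.
End Lift.

Lemma genmap1 k (t : gen k) : genmap (idf k) t = t.
Proof. by case: t => m [x g]; rewrite /genmap /mkgen /= compf1. Qed.

Lemma genmap_comp k l p (f : {ffun 'I_k -> 'I_l}) (g : {ffun 'I_l -> 'I_p}) t :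
  genmap (compf f g) t = genmap g (genmap f t).
Proof.
rewrite /genmap /=; set h := (tagged t).2.
suff -> : compf h (compf f g) = compf (compf h f) g by [].
by apply/ffunP=> i; rewrite !ffunE.
Qed.

Lemma genval_map k k' (f : {ffun 'I_k -> 'I_k'}) t : genval (genmap f t) = fact Q f (genval t).
Proof. by rewrite /genval /= fact_comp. Qed.

Definition freeMap k k' (f : {ffun 'I_k -> 'I_k'}) : {freeg (gen k) / K} -> {freeg (gen k') / K} :=
  fglift (fun t => << genmap f t >>).

Lemma fglift_map k k' (f : {ffun 'I_k -> 'I_k'}) (M : lmodType K) (h : gen k' -> M) D :
  fglift h (freeMap f D) = fglift (h \o genmap f) D.
Proof.
rewrite [RHS]fgliftE /freeMap [X in fglift h X]fgliftE fglift_sum.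
apply: eq_bigr => z _; rewrite -[_ *: _ in LHS]addr0 fglift_lin fglift0 addr0.
by rewrite liftU scale1r.
Qed.

Definition freeMod : FAmod K.
Proof.
refine {| fobj := fun k => {freeg (gen k) / K}; fact := freeMap |}.
- by move=> m n f a x y; apply: fglift_lin.
- move=> n x; rewrite /freeMap fgliftE -[RHS]freeg_sumE; apply: eq_bigr => z _.
  by rewrite genmap1; apply/eqP/freeg_eqP=> y; rewrite coeffZ !coeffU mul1r.
- move=> m n p f g x; rewrite {2}/freeMap fglift_map /freeMap !fgliftE.
  by apply: eq_bigr => z _; rewrite genmap_comp.
Defined.

Lemma freeMod_cover : is_nat (M := freeMod) (N := Q) (fun k => fglift (@genval k)).
Proof.
split=> [m a x y|m n f x]; first exact: fglift_lin.
rewrite [LHS]fglift_map !fgliftE fact_sum; apply: eq_bigr => z _.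
by rewrite /= genval_map factZ.
Qed.

Lemma freeMod_coverS k (y : fobj Q k) : exists x : fobj freeMod k, fglift (@genval k) x = y.
Proof.
by exists << mkgen y (idf k) >>; rewrite liftU scale1r /genval /= fact_id.
Qed.

Lemma mkgen_inj k m (x x' : fobj Q m) (g g' : {ffun 'I_m -> 'I_k}) :
  (mkgen x g == mkgen x' g') = (x == x') && (g == g').
Proof. by rewrite eq_Tagged /= xpair_eqE. Qed.

(** This is naturality of the projection onto the summand P_m indexed by [x], in the form of
    [pushPn]. *)
Lemma coeff_freeMap k k' (f : {ffun 'I_k -> 'I_k'}) m (x : fobj Q m) h D :
  coeff (mkgen x h) (freeMap f D) = \sum_(g | compf g f == h) coeff (mkgen x g) D.
Proof.
have cE l (z : gen l) E : coeff z E = fglift (fun y => (y == z)%:R : K^o) E by [].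
rewrite cE fglift_map fgliftE.
under [RHS]eq_bigr => g _ do rewrite cE fgliftE.
rewrite exchange_big; apply: eq_bigr => z _.
apply: etrans (scaler_sumr (coeff z D) _ _ (fun g => (z == mkgen x g)%:R : K^o)).
congr (_ *: _) => /=.
case: z => p [y g]; rewrite /genmap /=.
have [pm|pm] := eqVneq p m; last first.
  rewrite big1 => [|g' _]; last by rewrite -tag_eqE /tag_eq /= (negPf pm).
  by rewrite -tag_eqE /tag_eq /= (negPf pm).
case: m / pm x h => x h; rewrite mkgen_inj.
under eq_bigr => g' _ do rewrite [_ == _]mkgen_inj.
have [_|_] /= := eqVneq y x; last by rewrite big1.
have [gh|gh] := eqVneq (compf g f) h.
  rewrite (bigD1 g) ?gh //= eqxx big1 ?addr0 // => g' /andP[_ /negPf g'g].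
  by rewrite eq_sym g'g.
rewrite big1 // => g' g'h; case: eqP => // gg'; by rewrite gg' g'h in gh.
Qed.

End FreeCover.

(** * Indecomposable projectives as retracts of a full family *)

Section Completeness.
Variables (K : fieldType) (I : Type) (dm : I -> nat) (en : forall i, Pn K (dm i) (dm i)).
Arguments en : clear implicits.
Hypothesis enK : forall i, cornerK (en i).

Hypothesis en_full : forall n, exists s : seq {i : I & (Pn K n (dm i) * Pn K (dm i) n)%type},
  dl (idf n) = \sum_(t <- s) cmul (tagged t).1 (cmul (en (tag t)) (tagged t).2).

(* Gaussian elimination: the entries of [N] lie in an ideal of non-invertible morphisms, so 1 - N
   is invertible. *)
Lemma eliminate r (k : nat) (ns : nat -> nat) (es : forall l, Pn K (ns l) (ns l))
  (ys : forall l, Pn K (ns l) k) (N : forall l l', Pn K (ns l) (ns l')) :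
  (forall l l', (l < r)%N -> (l' < r)%N -> forall z, cmul (N l l') (cmul z (es l)) = 0) ->
  (forall l l', (l < r)%N -> (l' < r)%N -> cmul (N l l') (es l') = N l l') ->
  (forall l, (l < r)%N -> ys l = \sum_(l' < r) cmul (N l l') (ys l')) ->
  forall l, (l < r)%N -> ys l = 0.
Proof.
elim: r N => // r IHr N NJ Ne yE.
have Nrr : N r r = 0 by rewrite -Ne // -[es r]cmul1l NJ.
have yr : ys r = \sum_(l' < r) cmul (N r l') (ys l').
  by rewrite yE // big_ord_recr /= Nrr cmul0l addr0.
(* Substituting the last equation into the others gives coefficients that satisfy the same two
   conditions. *)
have y0 l : (l < r)%N -> ys l = 0.
  apply: (IHr (fun l l' => N l l' + cmul (N l r) (N r l'))) => {}l.
  - move=> l' lr lr' z; rewrite cmulDl -cmulA (cmulA (N r l')) !NJ ?addr0 // ltnS ltnW //.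
  - by move=> l' lr lr'; rewrite cmulDl -cmulA !Ne // ltnS ltnW.
  move=> lr; rewrite {1}yE ?ltnS 1?ltnW // big_ord_recr /= yr cmul_sumr -big_split.
  by apply: eq_bigr => l' _; rewrite cmulDl cmulA.
move=> l; rewrite ltnS leq_eqVlt => /predU1P[->|/y0 //].
by rewrite yr big1 // => l' _; rewrite y0 ?cmul0r.
Qed.

Variable Q : FAmod K.

(** Natural maps Q -> e KFA(dm fi,-) -> Q for [e = en fi], the second one given by Yoneda. *)
Record factorization := Factorization {
  fi : I;
  fa : forall m, fobj Q m -> Pn K (dm fi) m;
  fb : fobj Q (dm fi);
  fa_nat : natP fa;
  fa_fix : forall m q, cmul (en fi) (fa q) = fa q :> Pn K _ m;
  fb_fix : ev fb (en fi) = fb }.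

(** A section of the free cover has coordinates [co x], finitely many of them non-zero at [q], and
    [q] is the sum of the [ev x (co x q)]. Inserting [en_full] in each term makes it pass through
    the idempotents. *)
Lemma dual_basis k (q : fobj Q k) : projective Q ->
  exists s : seq factorization, q = \sum_(t <- s) ev (fb t) (fa t q).
Proof.
move=> Qproj.
have id_nat : is_nat (M := Q) (N := Q) (fun m x => x) by [].
have [s [[s_lin s_nat] sK]] := Qproj _ _ _ _ (freeMod_cover Q) (@freeMod_coverS _ Q) id_nat.
pose co m (x : fobj Q m) p (y : fobj Q p) : Pn K m p := [ffun g => coeff (mkgen x g) (s p y)].
have coP m x : natP (@co m x).
  split=> [p a y z|p p' f y].
    by apply/ffunP=> g; rewrite !ffunE s_lin coeffD coeffZ.
  rewrite -pushPnE; apply/ffunP=> h; rewrite !ffunE s_nat [LHS]coeff_freeMap.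
  by apply: eq_bigr => g _; rewrite ffunE.
(* Forgetting the map leaves the summand of the cover; [undup] below counts each summand once. *)
pose pr p (t : gen Q p) : {m : nat & fobj Q m} := Tagged (fobj Q) (tagged t).1.
have prK t (g : {ffun 'I_(tag t) -> 'I_k}) : pr k (mkgen (tagged t) g) = t by case: t g.
have mkK (z : gen Q k) g : z = mkgen (tagged z).1 g -> g = (tagged z).2.
  by case: z g => p [y h] g /eqP; rewrite [_ == _]mkgen_inj eqxx => /eqP.
have qE : q = \sum_(t <- undup (map (@pr k) (dom (s k q)))) ev (tagged t) (co _ (tagged t) _ q).
  rewrite -[LHS]sK fgliftE.
  (* Each [z] of the support is [mkgen (tagged t) g] for exactly one pair of [t] and [g]. *)
  transitivity (\sum_(t <- undup (map (@pr k) (dom (s k q))))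
     \sum_(g : {ffun 'I_(tag t) -> 'I_k}) \sum_(z <- dom (s k q))
     (z == mkgen (tagged t) g)%:R *: (coeff z (s k q) *: genval z)).
    under [RHS]eq_bigr do rewrite exchange_big.
    rewrite [RHS]exchange_big big_seq [RHS]big_seq; apply: eq_bigr => z zD.
    rewrite (bigD1_seq (pr _ z)) ?undup_uniq ?mem_undup ?map_f //=.
    rewrite (bigD1 (tagged z).2) //=.
    have -> : z == mkgen (tagged z).1 (tagged z).2 by case: (z) => ? [].
    rewrite scale1r !big1 ?addr0 // => [t tz|g gz].
      rewrite big1 // => g _; case: eqP => [zE|]; last by rewrite scale0r.
      by case/eqP: tz; rewrite zE prK.
    case: eqP => [zE|]; last by rewrite scale0r.
    by case/eqP: gz; apply: mkK.
  apply: eq_bigr => t _; apply: eq_bigr => g _; rewrite ffunE.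
  have [tD|tD] := boolP (mkgen (tagged t) g \in dom (s k q)); last first.
    rewrite coeff_outdom // scale0r big_seq big1 // => z zD.
    by case: eqP => [zE|]; [rewrite -zE zD in tD | rewrite scale0r].
  rewrite (bigD1_seq _ tD (uniq_dom _)) /= eqxx scale1r big1 ?addr0 // => z /negPf->.
  by rewrite scale0r.
suff [s1 s1E] : exists s1 : seq factorization, \sum_(t <- undup (map (@pr k) (dom (s k q))))
    ev (tagged t) (co _ (tagged t) _ q) = \sum_(t <- s1) ev (fb t) (fa t q).
  by exists s1; rewrite -s1E.
elim: (undup _) {qE} => [|[m x] l [s1 IHl]]; first by exists [::]; rewrite !big_nil.
rewrite big_cons IHl /=; have [s2 s2E] := en_full m.
pose T := {i : I & (Pn K m (dm i) * Pn K (dm i) m)%type}.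
pose a (t : T) p (y : fobj Q p) : Pn K (dm (tag t)) p := cmul (en (tag t)) (cmul (tagged t).2 (co m x p y)).
pose b (t : T) := ev x (cmul (tagged t).1 (en (tag t))).
have a_nat (t : T) : natP (a t).
  split=> [p k' y z|p p' f y]; first by rewrite /a (coP m x).1 !(cmulDr, cmulZr).
  by rewrite /a (coP m x).2 !cmulA.
have a_fix t p y : cmul (en (tag t)) (a t p y) = a t p y.
  by rewrite /a cmulA; have [_ -> _] := enK (tag t).
have b_fix t : ev (b t) (en (tag t)) = b t.
  by rewrite ev_ev -cmulA; have [_ -> _] := enK (tag t).
pose F t := Factorization (a_nat t) (a_fix t) (b_fix t).
exists (map F s2 ++ s1); rewrite big_cat big_map; congr (_ + _).
rewrite -[co m x k q]cmul1l s2E cmul_suml ev_sum; apply: eq_bigr => t _.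
by have [_ ee _] := enK (tag t); rewrite ev_ev /= /a -!cmulA [cmul (en _) (cmul (en _) _)]cmulA ee.
Qed.

(** Since [a] after [b] is an invertible scalar, Q is the direct sum of the image of [b] and the
    kernel of [a]. The image is non-zero, so the kernel vanishes. *)
Lemma indecomposable_retract i (a : forall m, fobj Q m -> Pn K (dm i) m) (b : fobj Q (dm i)) kappa :
  indecomposable Q -> natP a -> (forall m q, cmul (en i) (a m q) = a m q) ->
  ev b (en i) = b -> a _ b = kappa *: en i -> kappa != 0 -> retract Q (en i).
Proof.
move=> [_ Qind] aP ea be abk k0; have [e0 ee _] := enK i.
pose A m (q : fobj Q m) := exists v : Pn K (dm i) m, q = ev b v.
pose B m (q : fobj Q m) := a m q = 0.
have Asub : is_subfun A.
  split; first by move=> m; exists 0; rewrite ev0.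
  split=> [m k x y [u ->] [v ->]|m m' f x [u ->]].
    by exists (k *: u + v); rewrite ev_lin.
  by rewrite fact_ev; eexists.
have Bsub : is_subfun B.
  split; first by move=> m; apply: natP0.
  split=> [m k x y xB yB|m m' f x xB]; rewrite /B ?aP.1 ?aP.2 xB ?cmul0l //.
  by rewrite yB scaler0 addr0.
have [] := Qind A B Asub Bsub.
- move=> m _ [v ->]; rewrite /B (natP_ev aP) abk cmulZl => /eqP.
  rewrite scaler_eq0 (negPf k0) /= => /eqP ev0'.
  by rewrite -be ev_ev ev0' ev0.
- move=> m q; exists (kappa^-1 *: ev b (a m q)), (q - kappa^-1 *: ev b (a m q)).
  split; first by exists (kappa^-1 *: a m q); rewrite evZ.
  split; last by rewrite addrC subrK.
  rewrite /B -scaleNr addrC aP.1 (natP_ev aP) abk cmulZl ea scalerA mulNr mulVf //.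
  by rewrite scaleN1r addNr.
- move=> A0; case: e0; apply: (scalerI k0); rewrite -abk scaler0.
  rewrite [b](A0 _ b) ?(natP0 aP) //; by exists (dl (idf _)); rewrite ev1.
move=> B0; exists (kappa^-1 *: b), a; split=> //; last first.
  by rewrite (natPZ aP) abk scalerA mulVf // scale1r.
move=> m q; apply/eqP; rewrite eq_sym -subr_eq0; apply/eqP/B0.
rewrite /B evZl -scaleNr addrC aP.1 (natP_ev aP) abk cmulZl ea scalerA mulNr mulVf //.
by rewrite scaleN1r addNr.
Qed.

Lemma projective_indecomposable_retract :
  projective Q -> indecomposable Q -> exists i, retract Q (en i).
Proof.
move=> Qproj Qind; have [[k [q q0]] _] := Qind; have [s qE] := dual_basis q Qproj.
case: s qE => [|t0 s'] qE; first by rewrite big_nil in qE.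
set s := t0 :: s' in qE.
pose t l := nth t0 s l; pose r := size s.
(* The matrix entry stands for [fa (t l)] after [fb (t l')]. Testing it on basis maps [f] only makes
   the alternative below decidable. *)
pose N l l' := fa (t l) (fb (t l')).
have [/existsP[l /existsP[l' /existsP[f /eqP Nf]]]|] := boolP [exists l : 'I_r, exists l' : 'I_r,
    exists f : {ffun 'I_(dm (fi (t l'))) -> 'I_(dm (fi (t l)))},
    cmul (N l l') (cmul (dl f) (en (fi (t l)))) != 0].
  exists (fi (t l)); have [e0 ee eK] := enK (fi (t l)).
  have [kappa kE] := eK (cmul (N l l') (dl f)).
  have NE : cmul (N l l') (cmul (dl f) (en (fi (t l)))) = kappa *: en (fi (t l)).
    by rewrite -kE !cmulA [cmul (en _) _]fa_fix.
  apply: (@indecomposable_retract _ (@fa (t l)) (ev (fb (t l')) (cmul (dl f) (en (fi (t l))))) kappa) => //.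
  - exact: fa_nat.
  - exact: fa_fix.
  - by rewrite ev_ev -cmulA ee.
  - by rewrite (natP_ev (@fa_nat _)) NE.
  - by apply/eqP=> k0; apply: Nf; rewrite NE k0 scale0r.
rewrite negb_exists => /forallP N0.
have {}N0 l l' : (l < r)%N -> (l' < r)%N -> forall z, cmul (N l l') (cmul z (en (fi (t l)))) = 0.
  move=> lr lr' z; have := N0 (Ordinal lr); rewrite negb_exists => /forallP/(_ (Ordinal lr')).
  rewrite negb_exists => /forallP /= Nf.
  rewrite [cmul z _]cmul_dlE cmul_sumr big1 // => f _.
  by rewrite cmulZr; have := Nf f; rewrite negbK => /eqP->; rewrite scaler0.
have NE l l' : cmul (N l l') (en (fi (t l'))) = N l l'.
  by rewrite -(natP_ev (@fa_nat _)) fb_fix.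
(* Applying each [fa (t l)] to the expansion of [q] gives a system y = N y, whose only solution is
   0. *)
have y0 := @eliminate r k (fun l => dm (fi (t l))) (fun l => en (fi (t l)))
  (fun l => fa (t l) q) N N0 (fun l l' _ _ => NE l l').
case: q0; rewrite qE (big_nth t0) big_mkord big1 // => l _.
rewrite [fa _ q]y0 ?ev0 // => {}l lr.
rewrite {1}qE (natP_sum (@fa_nat _)) (big_nth t0) big_mkord.
by apply: eq_bigr => l' _; rewrite (natP_ev (@fa_nat _)).
Qed.

End Completeness.

(** * Young symmetrizers *)

Section PermutationPart.
Variables (K : fieldType) (n : nat).
Implicit Types (x y v : Pn K n n) (s t : 'S_n).

Lemma pf_inj_fun s : injectiveb (pf s).
Proof. by apply/injectiveP=> i j; rewrite !ffunE => /perm_inj. Qed.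

Lemma sum_injective (M : nmodType) (F : {ffun 'I_n -> 'I_n} -> M) :
  \sum_(f : {ffun 'I_n -> 'I_n} | injectiveb f) F f = \sum_(s : 'S_n) F (pf s).
Proof.
rewrite (reindex_onto (@pf n) (fun f => odflt 1%g [pick s : 'S_n | pf s == f])) => [|f f_inj] /=.
  apply: eq_bigl => s; rewrite pf_inj_fun; case: pickP => [t /eqP/pf_inj->|/(_ s)] /=.
    by rewrite eqxx.
  by rewrite eqxx.
case: pickP => [t /eqP //|/(_ (perm (injectiveP _ f_inj)))/eqP[]].
by apply/ffunP=> i; rewrite ffunE permE.
Qed.

(* The permutation part of [x]: reduction modulo the non-injective maps. *)
Definition pp x : Pn K n n := \sum_(s : 'S_n) x (pf s) *: pm s.

Lemma pp_split x : x = pp x + \sum_(f : {ffun 'I_n -> 'I_n} | ~~ injectiveb f) x f *: dl f.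
Proof. by rewrite {1}[x]dl_sum (bigID (fun f : {ffun 'I_n -> 'I_n} => injectiveb f)) /= sum_injective. Qed.

Lemma pmE s h : (pm s : Pn K n n) h = (h == pf s)%:R.
Proof. by rewrite ffunE. Qed.

Lemma pm_pfE s t : (pm s : Pn K n n) (pf t) = (t == s)%:R.
Proof. by rewrite pmE (inj_eq (@pf_inj n)). Qed.

Lemma ppD x y : pp (x + y) = pp x + pp y.
Proof. by rewrite -big_split; apply: eq_bigr => s _; rewrite ffunE scalerDl. Qed.

Lemma ppZ k x : pp (k *: x) = k *: pp x.
Proof. by rewrite scaler_sumr; apply: eq_bigr => s _; rewrite ffunE scalerA. Qed.

Lemma pp0 : pp 0 = 0.
Proof. by rewrite -(scale0r 0) ppZ !scale0r. Qed.

Lemma pp_sum I (r : seq I) (P : pred I) (F : I -> Pn K n n) :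
  pp (\sum_(i <- r | P i) F i) = \sum_(i <- r | P i) pp (F i).
Proof. exact: (big_morph _ ppD pp0). Qed.

Lemma pp_pm s : pp (pm s) = pm s.
Proof.
rewrite /pp (bigD1 s) //= pm_pfE eqxx scale1r big1 ?addr0 // => t ts.
by rewrite pm_pfE (negPf ts) scale0r.
Qed.

Lemma cmul_pmE s m (v : Pn K n m) h : cmul (pm s) v h = v (compf (pf s^-1%g) h).
Proof. by rewrite -permPnE ffunE; congr (v _); apply/ffunP=> i; rewrite !ffunE. Qed.

Lemma cmulr_pmE m (v : Pn K m n) s h : cmul v (pm s) h = v (compf h (pf s^-1%g)).
Proof.
rewrite -pushPnE ffunE (big_pred1 (compf h (pf s^-1%g))) // => g /=.
apply/eqP/eqP=> [<-|->]; apply/ffunP=> i; rewrite !ffunE ?permK ?permKV //.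
Qed.

Lemma cmul_noninj m p (f : {ffun 'I_m -> 'I_n}) (v : Pn K n p) (h : {ffun 'I_m -> 'I_p}) :
  ~~ injectiveb f -> injectiveb h -> cmul (dl f) v h = 0.
Proof.
move=> f_ninj /injectiveP h_inj; rewrite cmul_dlEr sum_ffunE big1 // => g _.
rewrite cmul_dl !ffunE; case: eqP => [hE|_]; last exact: mulr0.
case/injectiveP: f_ninj => i j fij; apply: h_inj.
by rewrite hE !ffunE fij.
Qed.

Lemma cmul_pfE x y s : cmul x y (pf s) = \sum_(t : 'S_n) x (pf t) * y (pf (t^-1 * s)%g).
Proof.
rewrite cmul_dlE sum_ffunE (bigID (fun f : {ffun 'I_n -> 'I_n} => injectiveb f)) /= sum_injective.
rewrite [X in _ + X]big1 ?addr0 => [|f f_ninj].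
  by apply: eq_bigr => t _; rewrite ffunE [dl _]/(pm t) cmul_pmE pfM.
by rewrite ffunE cmul_noninj ?pf_inj_fun //; apply: mulr0.
Qed.

(** Non-injective self-maps span an ideal, so [pp] is an algebra projection onto the group
    algebra. *)
Lemma pp_cmul x y : pp (cmul x y) = cmul (pp x) (pp y).
Proof.
rewrite [RHS]cmul_suml /pp.
transitivity (\sum_s \sum_(t : 'S_n) (x (pf t) * y (pf (t^-1 * s)%g)) *: (pm s : Pn K n n)).
  by apply: eq_bigr => s _; rewrite cmul_pfE scaler_suml.
rewrite exchange_big; apply: eq_bigr => t _ /=; rewrite cmulZl cmul_sumr scaler_sumr.
rewrite (reindex_inj (mulgI t)); apply: eq_bigr => s _.
by rewrite mulKg cmulZr pmM scalerA.
Qed.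

(* The trace of right multiplication by [x] on the group algebra is n! x(id). *)
Lemma square_zero_coef : (forall m, (m%:R == 0 :> K) = (m == 0%N)) ->
  forall x, cmul x x = 0 -> x (idf n) = 0.
Proof.
move=> K0 x xx; pose N := #|'S_n|.
pose M : 'M[K]_N := \matrix_(i, j) x (pf ((enum_val i)^-1 * enum_val j)%g).
have MM : M *m M = 0.
  apply/matrixP=> i j; rewrite !mxE.
  transitivity (cmul x x (pf ((enum_val i)^-1 * enum_val j)%g)); last by rewrite xx ffunE.
  rewrite cmul_pfE (reindex_inj (mulgI (enum_val i)^-1%g)).
  rewrite (reindex (@enum_val _ 'S_n)); last by apply: onW_bij; apply: enum_val_bij.
  apply: eq_bigr => k _; rewrite !mxE invMg invgK -mulgA; congr (_ * x (pf _)).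
  by rewrite mulKVg.
have trM : \tr M = 0.
  (* Rank factorization M = C R: here C cancels on the left and R on the right, so C R C R = 0
     forces R C = 0, which has the same trace as M. *)
  have CR : col_base M *m row_base M = M := mulmx_base M.
  have RC : row_base M *m col_base M = 0.
    apply: (row_full_inj (col_base_full M)); rewrite mulmx0.
    apply: (row_free_inj (row_base_free M)); rewrite mul0mx -mulmxA.
    by rewrite -mulmxA CR mulmxA CR.
  by rewrite -CR mxtrace_mulC RC mxtrace0.
have := trM; rewrite /mxtrace; under eq_bigr => i _ do rewrite mxE mulVg pf1.
rewrite sumr_const => /eqP; rewrite -mulr_natr mulf_eq0 K0 card_ord => /orP[/eqP //|].
by rewrite /N (cardD1 1%g).
Qed.

End PermutationPart.

(** * Row and column groups as stabilizers of a labelling *)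

Section Stabilizer.
Variables (K : fieldType) (n : nat) (label : 'I_n -> nat).
Let G := [set s : 'S_n | [forall i, label (s i) == label i]].

Implicit Types s t : 'S_n.

Lemma stabP s : reflect (forall i, label (s i) = label i) (s \in G).
Proof. by rewrite inE; apply: (iffP forallP) => sG i; apply/eqP. Qed.

Lemma stabV s : s \in G -> (s^-1)%g \in G.
Proof. by move=> /stabP sG; apply/stabP=> i; rewrite -[RHS](congr1 label (permKV s i)) sG. Qed.

Lemma stabM s t : s \in G -> t \in G -> (s * t)%g \in G.
Proof. by move=> /stabP sG /stabP tG; apply/stabP=> i; rewrite permM tG sG. Qed.

Lemma stabMl s t : s \in G -> ((s * t)%g \in G) = (t \in G).
Proof.
move=> sG; apply/idP/idP=> [/(stabM (stabV sG))|]; first by rewrite mulKg.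
exact: stabM.
Qed.

Lemma stabMr s t : s \in G -> ((t * s)%g \in G) = (t \in G).
Proof.
move=> sG; apply/idP/idP=> [/stabM/(_ (stabV sG))|tG]; first by rewrite mulgK.
exact: stabM.
Qed.

Lemma stab_tperm i j : label i = label j -> tperm i j \in G.
Proof. by move=> ij; apply/stabP=> k; case: tpermP => [->|->|]. Qed.

Lemma pm_sum_stab s : s \in G -> cmul (pm s) (\sum_(p in G) pm p) = \sum_(p in G) pm p :> Pn K n n.
Proof.
move=> sG; rewrite cmul_sumr [RHS](reindex_inj (mulgI s)).
by apply: eq_big => t; rewrite ?stabMl ?pmM.
Qed.

Lemma sum_stab_pm s : s \in G -> cmul (\sum_(p in G) pm p) (pm s) = \sum_(p in G) pm p :> Pn K n n.
Proof.
move=> sG; rewrite cmul_suml [RHS](reindex_inj (mulIg s)).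
by apply: eq_big => t; rewrite ?stabMr ?pmM.
Qed.

Lemma pm_altsum_stab s : s \in G ->
  cmul (pm s) (\sum_(p in G) (-1) ^+ odd_perm p *: pm p) =
  (-1) ^+ odd_perm s *: (\sum_(p in G) (-1) ^+ odd_perm p *: pm p) :> Pn K n n.
Proof.
move=> sG; rewrite cmul_sumr [in RHS](reindex_inj (mulgI s)) scaler_sumr.
apply: eq_big => t; rewrite ?stabMl // => tG.
by rewrite cmulZr pmM scalerA odd_permM signr_addb signrMK.
Qed.

Lemma altsum_stab_pm s : s \in G ->
  cmul (\sum_(p in G) (-1) ^+ odd_perm p *: pm p) (pm s) =
  (-1) ^+ odd_perm s *: (\sum_(p in G) (-1) ^+ odd_perm p *: pm p) :> Pn K n n.
Proof.
move=> sG; rewrite cmul_suml [in RHS](reindex_inj (mulIg s)) scaler_sumr.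
apply: eq_big => t; rewrite ?stabMr // => tG.
by rewrite cmulZl pmM scalerA odd_permM addbC signr_addb signrMK.
Qed.

End Stabilizer.

(** * Products of Young symmetrizers, and central elements *)

Section Symmetrizers.
Variable K : fieldType.
Hypothesis K0 : forall m, (m%:R == 0 :> K) = (m == 0%N).

Definition asym n la : Pn K n n := \sum_(p in rowGroup n la) pm p.
Definition bsym n la : Pn K n n := \sum_(q in colGroup n la) (-1) ^+ odd_perm q *: pm q.
(** The right action of c = a b becomes left multiplication with the factors reversed, whence [bsym]
    first. *)
Definition ysym n la : Pn K n n := cmul (bsym n la) (asym n la).

Lemma youngE n m la (v : Pn K n m) : young la v = cmul (ysym n la) v.
Proof.
rewrite /ysym -cmulA /young exchange_big cmul_suml /=.
apply: eq_bigr => q _; rewrite cmulZl !cmul_suml cmul_sumr scaler_sumr.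
by apply: eq_bigr => p _; rewrite !permPnE.
Qed.

Lemma pm_asym n la (p : 'S_n) : p \in rowGroup n la -> cmul (pm p) (asym n la) = asym n la.
Proof. exact: pm_sum_stab. Qed.

Lemma asym_pm n la (p : 'S_n) : p \in rowGroup n la -> cmul (asym n la) (pm p) = asym n la.
Proof. exact: sum_stab_pm. Qed.

Lemma bsym_pm n la (q : 'S_n) : q \in colGroup n la ->
  cmul (bsym n la) (pm q) = (-1) ^+ odd_perm q *: bsym n la.
Proof. exact: altsum_stab_pm. Qed.

Lemma pp_asym n la : pp (asym n la) = asym n la.
Proof. by rewrite /asym pp_sum; apply: eq_bigr => p _; rewrite pp_pm. Qed.

Lemma pp_bsym n la : pp (bsym n la) = bsym n la.
Proof. by rewrite /bsym pp_sum; apply: eq_bigr => p _; rewrite ppZ pp_pm. Qed.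

Lemma pp_ysym n la : pp (ysym n la) = ysym n la.
Proof. by rewrite pp_cmul pp_asym pp_bsym. Qed.

Lemma neg_eq0 (V : lmodType K) (x : V) : x = - x -> x = 0.
Proof.
move=> xN; apply: (@scalerI _ _ 2%:R); first by rewrite K0.
by rewrite scaler0 -[2%:R]/(1 + 1) scalerDl scale1r {2}xN subrr.
Qed.

(** The transposition of [i] and [j] is absorbed by [asym]; carried across [g] it becomes a
    transposition in a column, which [bsym] absorbs with sign -1. So the product equals its
    opposite. *)
Lemma bsym_asym0 n la mu (g : 'S_n) (i j : 'I_n) : i != j ->
  rowOf la i = rowOf la j -> colOf mu ((g^-1)%g i) = colOf mu ((g^-1)%g j) ->
  cmul (bsym n mu) (cmul (pm g) (asym n la)) = 0.
Proof.
move=> ij rij cij; have tR : tperm i j \in rowGroup n la by apply: stab_tperm.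
have tC : tperm ((g^-1)%g i) ((g^-1)%g j) \in colGroup n mu by apply: stab_tperm.
apply: neg_eq0; rewrite -{1}(pm_asym tR) (cmulA (pm g)) pmM.
have -> : (g * tperm i j = tperm ((g^-1)%g i) ((g^-1)%g j) * g)%g.
  by rewrite -tpermJ conjgE invgK -!mulgA mulVg mulg1.
rewrite -pmM -cmulA cmulA (bsym_pm tC) odd_tperm (inj_eq perm_inj) ij expr1.
by rewrite scaleN1r cmulNl.
Qed.

Lemma asym_span n la mu : (forall g, cmul (bsym n mu) (cmul (pm g) (asym n la)) = 0) ->
  forall x, cmul (bsym n mu) (cmul (pp x) (asym n la)) = 0.
Proof.
move=> H x; rewrite [cmul (pp x) _]cmul_suml [LHS]cmul_sumr big1 // => g _.
by rewrite cmulZl cmulZr H scaler0.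
Qed.

(** Without a collision as in [bsym_asym0], [rows_split_dominance] would contradict the strict
    inequality. *)
Lemma bsym_asym_dominance n la mu k : is_partition mu -> sumn la = n -> sumn mu = n ->
  (sumn (take k mu) < sumn (take k la))%N ->
  forall x, cmul (bsym n mu) (cmul (pp x) (asym n la)) = 0.
Proof.
move=> mu_p la_n mu_n lt; apply: asym_span => g.
have [/existsP[i /existsP[j /and3P[ij /eqP rij /eqP cij]]]|H] := boolP [exists i : 'I_n, exists j : 'I_n,
  [&& i != j, rowOf la i == rowOf la j & colOf mu ((g^-1)%g i) == colOf mu ((g^-1)%g j)]].
  exact: bsym_asym0 ij rij cij.
move: lt; rewrite ltnNge => /negP[].
apply: (rows_split_dominance (h := (g^-1)%g)) => // i j ij rij cij.
by case/negP: H; apply/existsP; exists i; apply/existsP; exists j; rewrite ij rij cij !eqxx.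
Qed.

Lemma ysym_sandwich n la mu x :
  cmul (ysym n mu) (cmul (pp x) (ysym n la)) =
  cmul (bsym n mu) (cmul (pp (cmul (asym n mu) (cmul x (bsym n la)))) (asym n la)).
Proof. by rewrite !pp_cmul pp_asym pp_bsym /ysym !cmulA. Qed.

(** Some partial sums differ, and dominance kills the product in one order, depending on which is
    larger. One order suffices: composites e -> e' -> e contain both, and the [zsym] commute. *)
Lemma ysym_orth n la mu : is_partition la -> is_partition mu -> sumn la = n -> sumn mu = n ->
  la <> mu ->
  (forall x, cmul (ysym n mu) (cmul (pp x) (ysym n la)) = 0) \/
  (forall x, cmul (ysym n la) (cmul (pp x) (ysym n mu)) = 0).
Proof.
move=> la_p mu_p la_n mu_n lamu.
(* Beyond the longer of the two lengths both partial sums are [n], so a finite search is enough. *)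
have [/existsP[k]|] := boolP [exists k : 'I_(maxn (size la) (size mu)).+1,
    sumn (take k la) != sumn (take k mu)].
  rewrite neq_ltn => /orP[lt|lt]; [right | left] => x; rewrite ysym_sandwich;
    exact: bsym_asym_dominance lt _.
rewrite negb_exists => /forallP same; case: lamu; apply: partition_inj => // k.
have [kM|kM] := ltnP k (maxn (size la) (size mu)).+1.
  by have := same (Ordinal kM); rewrite negbK => /eqP.
by rewrite !take_oversize ?la_n ?mu_n // (leq_trans _ (ltnW kM)) ?leq_maxl ?leq_maxr.
Qed.

(** Each permutation [g] either has a collision and contributes 0, or its inverse factors by
    [rows_split_factor] and the two symmetrizers absorb the factors up to sign. *)
Lemma bsym_asym_scalar n la x : is_partition la -> sumn la = n ->
  exists k, cmul (bsym n la) (cmul (pp x) (asym n la)) = k *: ysym n la.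
Proof.
move=> la_p la_n; rewrite /pp.
apply: (big_ind (fun y => exists k, cmul (bsym n la) (cmul y (asym n la)) = k *: ysym n la)).
- by exists 0; rewrite cmul0l cmul0r scale0r.
- by move=> u v [k uk] [l vl]; exists (k + l); rewrite cmulDl cmulDr uk vl scalerDl.
move=> g _.
suff [k gk] : exists k, cmul (bsym n la) (cmul (pm g) (asym n la)) = k *: ysym n la.
  by exists (x (pf g) * k); rewrite cmulZl cmulZr gk scalerA.
have [/existsP[i /existsP[j /and3P[ij /eqP rij /eqP cij]]]|H] := boolP [exists i : 'I_n, exists j : 'I_n,
  [&& i != j, rowOf la i == rowOf la j & colOf la ((g^-1)%g i) == colOf la ((g^-1)%g j)]].
  by exists 0; rewrite scale0r; apply: bsym_asym0 ij rij cij.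
have [i j ij rij cij|p [q [pR qC gE]]] := rows_split_factor (h := (g^-1)%g) la_n la_p.
  by case/negP: H; apply/existsP; exists i; apply/existsP; exists j; rewrite ij rij cij !eqxx.
exists ((-1) ^+ odd_perm (q^-1)%g); rewrite -[g]invgK gE invMg -pmM -cmulA pm_asym ?stabV //.
by rewrite cmulA bsym_pm ?stabV // cmulZl.
Qed.

Lemma ysym_scalar n la x : is_partition la -> sumn la = n ->
  exists k, cmul (ysym n la) (cmul (pp x) (ysym n la)) = k *: ysym n la.
Proof. by move=> la_p la_n; rewrite ysym_sandwich; apply: bsym_asym_scalar. Qed.

Lemma rowcol_trivial n la (s : 'S_n) : s \in rowGroup n la -> s \in colGroup n la -> s = 1%g.
Proof.
move=> /stabP sR /stabP sC; apply/permP=> i; rewrite perm1; apply: val_inj => /=.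
by rewrite -(boxposK la (s i)) sR sC boxposK.
Qed.

(** Row and column groups meet trivially, so only the pair of identities contributes. *)
Lemma ysym_id n la : ysym n la (idf n) = 1.
Proof.
rewrite /ysym /bsym cmul_suml sum_ffunE (bigD1 1%g) /=; last by apply/stabP=> i; rewrite perm1.
rewrite cmulZl !ffunE odd_perm1 scale1r cmul_sumr sum_ffunE (bigD1 1%g) /=; last first.
  by apply/stabP=> i; rewrite perm1.
rewrite pmM mulg1 -pf1 pm_pfE eqxx big1 ?addr0 => [|p /andP[pR p1]]; last first.
  by rewrite pmM mul1g pm_pfE eq_sym (negPf p1).
rewrite big1 ?addr0 // => q /andP[qC q1]; rewrite cmulZl ffunE cmul_sumr sum_ffunE big1.
  exact: scaler0.
move=> p pR; rewrite pmM pm_pfE; case: eqP => // /eqP; rewrite eq_sym -eq_invg_mul => /eqP qp.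
case/eqP: q1; apply: (rowcol_trivial (la := la)) => //.
by rewrite -[q]invgK qp; apply: stabV.
Qed.

Definition alpha n la : K := cmul (ysym n la) (ysym n la) (idf n).

Lemma ysym_sq n la : is_partition la -> sumn la = n ->
  cmul (ysym n la) (ysym n la) = alpha n la *: ysym n la.
Proof.
move=> la_p la_n; have [k kE] := ysym_scalar (pm 1%g) la_p la_n.
have E : cmul (ysym n la) (ysym n la) = k *: ysym n la.
  by rewrite -kE pp_pm /pm pf1 cmul1l.
by rewrite /alpha E ffunE ysym_id [k *: 1]mulr1.
Qed.

(** Otherwise [ysym] would square to 0 with identity coefficient 1, against [square_zero_coef]. *)
Lemma alpha_neq0 n la : is_partition la -> sumn la = n -> alpha n la != 0.
Proof.
move=> la_p la_n; apply/eqP=> a0; have := ysym_sq la_p la_n; rewrite a0 scale0r.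
by move/(square_zero_coef K0)/eqP; rewrite ysym_id oner_eq0.
Qed.

(** Summing over conjugates makes the symmetrizer central: up to a non-zero scalar, this is the
    central idempotent of S_la. *)
Definition zsym n la : Pn K n n := \sum_(g : 'S_n) cmul (pm g^-1%g) (cmul (ysym n la) (pm g)).

Lemma pp_zsym n la : pp (zsym n la) = zsym n la.
Proof. by rewrite /zsym pp_sum; apply: eq_bigr => g _; rewrite pp_cmul pp_cmul !pp_pm pp_ysym. Qed.

Lemma zsym_pm n la s : cmul (zsym n la) (pm s) = cmul (pm s) (zsym n la).
Proof.
rewrite /zsym cmul_suml cmul_sumr (reindex_inj (mulIg s^-1%g)); apply: eq_bigr => g _ /=.
by rewrite invMg invgK -!pmM -!cmulA pmM mulVg /pm pf1 cmul1r.
Qed.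

Lemma zsym_comm n la x : cmul (zsym n la) (pp x) = cmul (pp x) (zsym n la).
Proof.
rewrite [LHS]cmul_sumr [RHS]cmul_suml; apply: eq_bigr => s _.
by rewrite cmulZl cmulZr zsym_pm.
Qed.

Lemma zsym_id n la : zsym n la (idf n) = #|'S_n|%:R.
Proof.
rewrite sum_ffunE -sum1_card natr_sum; apply: eq_bigr => g _.
by rewrite cmul_pmE cmulr_pmE -pf1 !pfM mulg1 invgK mulgV pf1 ysym_id.
Qed.

(** By centrality the corner scalar of [zsym] makes it act by a scalar on [ysym], hence on every
    conjugate and on itself. The scalar is non-zero by [square_zero_coef], the identity coefficient
    being n!. *)
Lemma zsym_sq n la : is_partition la -> sumn la = n ->
  exists2 k, k != 0 & cmul (zsym n la) (zsym n la) = k *: zsym n la.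
Proof.
move=> la_p la_n; have a0 := alpha_neq0 la_p la_n.
have [k kE] := ysym_scalar (zsym n la) la_p la_n.
have zy : cmul (zsym n la) (ysym n la) = (k / alpha n la) *: ysym n la.
  apply: (scalerI a0); rewrite scalerA mulrC divfK // -kE pp_zsym -cmulZr -(ysym_sq la_p la_n).
  have zyC : cmul (zsym n la) (ysym n la) = cmul (ysym n la) (zsym n la).
    by rewrite -pp_ysym zsym_comm.
  by rewrite [LHS]cmulA zyC -cmulA zyC.
have zz : cmul (zsym n la) (zsym n la) = (k / alpha n la) *: zsym n la.
  rewrite {2}/zsym cmul_sumr scaler_sumr; apply: eq_bigr => g _.
  by rewrite cmulA zsym_pm -cmulA (cmulA (zsym _ _)) zy cmulZl cmulZr.
exists (k / alpha n la) => //; apply/eqP=> k0; move: zz; rewrite k0 scale0r.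
by move/(square_zero_coef K0)/eqP; rewrite zsym_id K0 (cardD1 1%g).
Qed.

Lemma zsym_orth n la mu : is_partition la -> is_partition mu -> sumn la = n -> sumn mu = n ->
  la <> mu -> cmul (zsym n la) (zsym n mu) = 0.
Proof.
have zz l m : (forall x, cmul (ysym n l) (cmul (pp x) (ysym n m)) = 0) ->
    cmul (zsym n l) (zsym n m) = 0.
  move=> H; rewrite cmul_suml big1 // => g _; rewrite cmul_sumr big1 // => h _.
  transitivity (cmul (pm g^-1%g) (cmul (cmul (ysym n l) (cmul (pp (pm (g * h^-1)%g)) (ysym n m))) (pm h))).
    by rewrite pp_pm -pmM !cmulA.
  by rewrite H cmul0l cmul0r.
move=> la_p mu_p la_n mu_n lamu; have [/zz zz0|/zz //] := ysym_orth la_p mu_p la_n mu_n lamu.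
by rewrite -[zsym n mu]pp_zsym zsym_comm pp_zsym.
Qed.

Lemma zsym_class n la s t : zsym n la (pf (s ^ t)%g) = zsym n la (pf s).
Proof.
have := congr1 (fun z : Pn K n n => z (pf (t * s ^ t)%g)) (zsym_pm la t).
by rewrite cmul_pmE cmulr_pmE !pfM mulKg conjgE mulKVg mulgK.
Qed.

End Symmetrizers.

(** * Cycle types and conjugacy *)

Section CycleType.
Variable n : nat.
Implicit Types (s t : 'S_n) (x y : 'I_n).

Definition orbit_sizes s := [seq fingraph.order s x | x <- enum (froots s)].
Definition cycle_type s := sort geq (orbit_sizes s).

Lemma cycle_type_partition s : is_partition (cycle_type s).
Proof.
apply/andP; split; first by apply: sort_sorted => x y; apply: leq_total.
by rewrite all_sort; apply/allP=> _ /mapP[x _ ->]; apply: fingraph.order_gt0.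
Qed.

Lemma sumn_cycle_type s : sumn (cycle_type s) = n.
Proof.
have -> : sumn (cycle_type s) = sumn (orbit_sizes s).
  by apply: perm_sumn; rewrite perm_sort.
have sym := fconnect_sym (@perm_inj _ s).
rewrite sumnE big_map big_enum /= -[RHS]card_ord -[RHS]sum1_card.
rewrite [RHS](partition_big (froot s) (mem (froots s))) /= => [|x _]; last exact: roots_root.
apply: eq_bigr => x xr; rewrite sum1_card; apply: eq_card => y.
by rewrite -[RHS]/(froot s y == x) -[in RHS](eqP xr) root_connect // sym.
Qed.

Lemma root_froot s x : froot s x \in froots s.
Proof. exact: roots_root (fconnect_sym (@perm_inj _ s)) x. Qed.

Lemma connect_froot s x : fconnect s (froot s x) x.
Proof. by rewrite (fconnect_sym (@perm_inj _ s)); apply: connect_root. Qed.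

Lemma same_froot s x y : fconnect s x y -> froot s x = froot s y.
Proof. by move/(fingraph.rootP (fconnect_sym (@perm_inj _ s))). Qed.

(** Cycles of equal length are matched by their roots ([F]), and [h] sends the j-th iterate of a
    root under [s] to the j-th iterate of its match under [t]. *)
Lemma cycle_type_conj s t : cycle_type s = cycle_type t -> exists h : 'S_n, t = (s ^ h)%g.
Proof.
move=> st; pose xs := enum (froots s).
have [x0 _|xs0] := pickP 'I_n.
  have /perm_iotaP : perm_eq (orbit_sizes s) (orbit_sizes t).
    by rewrite -(perm_sort geq) -/(cycle_type s) st perm_sort.
  move=> /(_ 0%N)[Is IsP sE].
  pose ys := map (nth x0 (enum (froots t))) Is.
  have ysP : perm_eq ys (enum (froots t)).
    by apply/(perm_iotaP x0); exists Is => //; move: IsP; rewrite size_map.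
  have ys_uniq : uniq ys by rewrite (perm_uniq ysP) enum_uniq.
  have sz : size ys = size xs by rewrite -(size_map (fingraph.order s) xs) [map _ _]sE !size_map.
  have ys_order i : (i < size xs)%N -> fingraph.order t (nth x0 ys i) = fingraph.order s (nth x0 xs i).
    move=> ixs; have iIs : (i < size Is)%N by rewrite -sz size_map in ixs.
    have jlt : (nth 0%N Is i < size (enum (froots t)))%N.
      have : nth 0%N Is i \in Is by apply: mem_nth.
      by rewrite (perm_mem IsP) mem_iota size_map.
    have := congr1 (fun u => nth 0%N u i) sE; rewrite /orbit_sizes.
    by rewrite (nth_map x0) // (nth_map 0%N) // (nth_map x0) // (nth_map 0%N).
  pose F x := nth x0 ys (index (froot s x) xs).
  have idx x : (index (froot s x) xs < size xs)%N.
    by rewrite index_mem mem_enum root_froot.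
  have Froot x : froot t (F x) = F x.
    have : F x \in enum (froots t) by rewrite -(perm_mem ysP) mem_nth // sz.
    by rewrite mem_enum => /eqP.
  have Forder x : fingraph.order t (F x) = fingraph.order s (froot s x).
    by rewrite ys_order // nth_index // mem_enum root_froot.
  pose h x := iter (findex s (froot s x) x) t (F x).
  have jlt x : (findex s (froot s x) x < fingraph.order s (froot s x))%N.
    exact: findex_max (connect_froot s x).
  have h_step x : h (s x) = t (h x).
    have rE : froot s (s x) = froot s x by rewrite -(same_froot (fconnect1 s x)).
    rewrite /h /F rE -/(F x) -iterS.
    have sxE : s x = iter (findex s (froot s x) x).+1 s (froot s x).
      by rewrite iterS iter_findex // connect_froot.
    (* At the end of a cycle [s] returns to the root, and so does [t] because the lengths agree. *)
    rewrite sxE; move: (jlt x); rewrite leq_eqVlt => /predU1P[->|jlt'].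
      rewrite iter_order; last exact: perm_inj.
      by rewrite findex0 -Forder iter_order //; apply: perm_inj.
    by rewrite findex_iter.
  have h_inj : injective h.
    move=> x y hxy.
    have Fxy : F x = F y.
      rewrite -Froot -[RHS]Froot (same_froot (fconnect_iter t (findex s (froot s x) x) (F x))).
      by rewrite [RHS](same_froot (fconnect_iter t (findex s (froot s y) y) (F y))) -/(h x) hxy.
    have rxy : froot s x = froot s y.
      have /eqP := Fxy; rewrite nth_uniq ?sz // => /eqP ixy.
      have rxs z : froot s z \in xs by rewrite mem_enum root_froot.
      by rewrite -(nth_index x0 (rxs x)) ixy nth_index.
    have : findex t (F x) (h x) = findex t (F y) (h y) by rewrite Fxy hxy.
    rewrite !findex_iter ?Forder // => jxy.
    by rewrite -(iter_findex (connect_froot s x)) jxy rxy iter_findex ?connect_froot.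
  exists (perm h_inj); apply/permP=> x; rewrite conjgE !permM -{1}[x](permKV (perm h_inj)) !permE.
  by rewrite h_step.
by exists 1%g; apply/permP=> x; have := xs0 x.
Qed.

End CycleType.

(** * The unit of the group algebra as a combination of central elements *)

Section GroupAlgebra.
Variable K : fieldType.
Hypothesis K0 : forall m, (m%:R == 0 :> K) = (m == 0%N).

(* The central elements [zsym n la] are linearly independent, and by [cycle_type_conj] there are
   at least as many of them as conjugacy classes, so they span the centre. *)
Lemma one_zsym n : exists r : seq (seq nat * K),
  (forall t, t \in r -> is_partition t.1 /\ sumn t.1 = n) /\
  dl (idf n) = \sum_(t <- r) t.2 *: zsym K n t.1.
Proof.
pose Ty := undup [seq cycle_type s | s <- enum {: 'S_n}]; pose N := size Ty.
have TyP la : la \in Ty -> exists s : 'S_n, cycle_type s = la.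
  by rewrite mem_undup => /mapP[s _ ->]; exists s.
pose ty (i : 'I_N) := nth [::] Ty i.
have tyP i : ty i \in Ty by apply: mem_nth.
have ty_part i : is_partition (ty i).
  by have [s <-] := TyP _ (tyP i); apply: cycle_type_partition.
have ty_sum i : sumn (ty i) = n by have [s <-] := TyP _ (tyP i); apply: sumn_cycle_type.
have ty_inj i j : i != j -> ty i <> ty j.
  by move=> ij /eqP; rewrite nth_uniq ?undup_uniq // => /eqP/val_inj/eqP; rewrite (negPf ij).
have tyS (s : 'S_n) : exists i, ty i = cycle_type s.
  have sT : cycle_type s \in Ty by rewrite mem_undup; apply: map_f; rewrite mem_enum.
  have idx : (index (cycle_type s) Ty < N)%N by rewrite index_mem.
  by exists (Ordinal idx); rewrite /ty nth_index.
pose rep i : 'S_n := odflt 1%g [pick s | cycle_type s == ty i].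
have repP i : cycle_type (rep i) = ty i.
  rewrite /rep; case: pickP => [s /eqP //|].
  by have [s sE] := TyP _ (tyP i); move/(_ s); rewrite sE eqxx.
pose z (u : 'rV[K]_N) : Pn K n n := \sum_i u 0 i *: zsym K n (ty i).
have z_rep u (s : 'S_n) i : cycle_type s = ty i -> z u (pf s) = z u (pf (rep i)).
  rewrite -repP => /cycle_type_conj[h ->]; rewrite !sum_ffunE; apply: eq_bigr => j _.
  by rewrite !ffunE zsym_class.
(* Values of the central elements on class representatives; this square matrix is invertible by
   orthogonality of the [zsym]. *)
pose W : 'M[K]_N := \matrix_(i < N, j < N) zsym K n (ty i) (pf (rep j)).
have zW u j : (u *m W) 0 j = z u (pf (rep j)).
  by rewrite mxE sum_ffunE; apply: eq_bigr => i _; rewrite !mxE ffunE.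
have pp_z u : pp (z u) = z u.
  by rewrite pp_sum; apply: eq_bigr => i _; rewrite ppZ pp_zsym.
have W_free : row_free W.
  apply: inj_row_free => u uW0; have z0 : z u = 0.
    rewrite -pp_z /pp big1 // => s _; have [i /esym/z_rep->] := tyS s.
    by rewrite -zW uW0 mxE scale0r.
  apply/rowP=> i; rewrite mxE; have [k k0 zz] := zsym_sq K0 (ty_part i) (ty_sum i).
  have := congr1 (cmul^~ (zsym K n (ty i))) z0; rewrite /= cmul0l cmul_suml (bigD1 i) //= big1.
    rewrite addr0 cmulZl zz scalerA => /(congr1 (fun v : Pn K n n => v (idf n))).
    rewrite !ffunE zsym_id // => /eqP; rewrite /GRing.scale /= !mulf_eq0 (negPf k0) K0.
    by rewrite (cardD1 1%g) /= !orbF => /eqP.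
  move=> j ji; rewrite cmulZl (zsym_orth K0 (ty_part j) (ty_part i)) ?ty_sum ?scaler0 //.
  exact: ty_inj.
pose d : 'rV[K]_N := \row_j (pm 1%g : Pn K n n) (pf (rep j)).
pose u := d *m invmx W.
have uW : u *m W = d by apply: mulmxKV; rewrite -row_free_unit.
exists [seq (ty i, u 0 i) | i <- enum 'I_N]; split.
  by move=> _ /mapP[i _ ->]; split; [apply: ty_part | apply: ty_sum].
rewrite big_map big_enum /= -/(z u) -pf1 -[dl _]/(pm 1%g) -[LHS]pp_pm -[RHS]pp_z.
apply: eq_bigr => s _; congr (_ *: _); have [i /esym sE] := tyS s.
rewrite (z_rep _ _ _ sE) -zW uW mxE !pm_pfE; congr (_%:R).
(* Conjugation fixes 1, so [s] is 1 exactly when its representative is. *)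
have : exists h, rep i = (s ^ h)%g by apply: cycle_type_conj; rewrite repP.
by case=> h ->; rewrite -[in RHS](conj1g h) (inj_eq (conjg_inj h)).
Qed.

End GroupAlgebra.

(** * The listed functors *)

Section NonSurjective.

Lemma noninj_nonsurj k n (f : {ffun 'I_k -> 'I_n}) :
  (k < n)%N || (k <= n)%N && ~~ injectiveb f -> exists j, forall i, f i != j.
Proof.
move=> H; have [j jf|full] := pickP [pred j | j \notin codom f].
  by exists j => i; apply: contraNneq jf => <-; apply: codom_f.
have cardf : #|codom f| = n.
  rewrite -[RHS]card_ord; apply: eq_card => j; have := full j; rewrite inE /=.
  by rewrite [j \in 'I_n]inE => /negbFE.
have le : (#|codom f| <= k)%N by rewrite -[k in (_ <= k)%N]card_ord; apply: leq_image_card.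
case/orP: H => [kn|/andP[kn]]; first by rewrite cardf leqNgt kn in le.
have nk : n = k by apply/eqP; rewrite eqn_leq kn -{1}cardf le.
case/negP; apply/injectiveP; have /image_injP : #|image f 'I_k| == #|'I_k|.
  by rewrite -[image f _]/(codom f) cardf card_ord nk.
by move=> f_inj i j; apply: f_inj.
Qed.

(** The image has fewer than [k] elements, hence at most [n - 2]. *)
Lemma noninj_miss2 k n (f : {ffun 'I_k -> 'I_n}) : (k < n)%N -> ~~ injectiveb f ->
  exists j1 j2, [/\ j1 != j2, forall i, f i != j1 & forall i, f i != j2].
Proof.
move=> kn f_ninj; have lt : (#|codom f| < k)%N.
  rewrite ltn_neqAle -[k in (_ <= k)%N]card_ord leq_image_card andbT.
  apply: contraNneq f_ninj => cf; apply/injectiveP.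
  have /image_injP f_inj : #|image f 'I_k| == #|'I_k| by rewrite card_ord -[image f _]/(codom f) cf.
  by move=> i j; apply: f_inj.
have : (1 < #|[predC codom f]|)%N.
  by rewrite -(ltn_add2l #|codom f|) cardC card_ord addn1; apply: leq_ltn_trans kn.
case/card_gt1P=> j1 [j2 []]; rewrite !inE => j1f j2f j12; exists j1, j2; split=> // i.
  by apply: contraNneq j1f => <-; apply: codom_f.
by apply: contraNneq j2f => <-; apply: codom_f.
Qed.

End NonSurjective.

(** * Tensors in the powers of Pbar *)

Section ReducedTensors.
Variable K : fieldType.

Lemma cmul_dl_coef k n m (f : {ffun 'I_k -> 'I_n}) (v : Pn K n m) h :
  cmul (dl f) v h = \sum_(g | compf f g == h) v g.
Proof.
rewrite cmul_dlEr sum_ffunE [RHS]big_mkcond; apply: eq_bigr => g _.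
rewrite cmul_dl !ffunE eq_sym; case: ifP => _; [exact: mulr1 | exact: mulr0].
Qed.

(** The trace of membership in Pbar^n that the computations use: a place [j] outside the image of
    [f] has its factor replaced by its coefficient sum, 0. *)
Definition reducedT n m (v : Pn K n m) :=
  forall k (f : {ffun 'I_k -> 'I_n}), (exists j, forall i, f i != j) -> cmul (dl f) v = 0.

Lemma ptensor_reducedT n m (w : n.-tuple {ffun 'I_m -> K^o}) :
  (forall i, \sum_x tnth w i x = 0) -> reducedT (ptensor w).
Proof.
move=> w0 k f [j fj]; apply/ffunP=> h; rewrite cmul_dl_coef [RHS]ffunE.
(* The choices of [g l] are independent, constrained only by [h] on the fibre of [f] over [l]; over
   [j] the fibre is empty and all values occur. *)
pose Q l x := [forall i, (f i == l) ==> (x == h i)].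
transitivity (\sum_(g in family Q) \prod_l tnth w l (g l)).
  apply: eq_big => [g|g _]; last by rewrite ffunE.
  apply/eqP/familyP=> [hE l|H].
    by apply/forallP=> i; apply/implyP=> /eqP<-; rewrite -hE ffunE.
  by apply/ffunP=> i; rewrite ffunE; apply/eqP/(implyP (forallP (H (f i)) i)).
rewrite -(bigA_distr_big_dep Q (fun l x => tnth w l x)) (bigD1 j) //=.
rewrite (eq_bigl xpredT) => [|x]; first by rewrite w0 mul0r.
by apply/forallP=> i; rewrite (negPf (fj i)).
Qed.

Lemma inPbarT_reducedT n m (v : Pn K n m) : inPbarT v -> reducedT v.
Proof.
move=> [s [s0 ->]] k f fj; rewrite cmul_sumr big_seq big1 // => c cs.
by rewrite cmulZr (ptensor_reducedT (s0 c cs)) ?scaler0.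
Qed.

Lemma pushPn_ptensor n m m' (f : {ffun 'I_m -> 'I_m'}) (w : n.-tuple {ffun 'I_m -> K^o}) :
  pushPn f (ptensor w) =
  ptensor [tuple [ffun y => \sum_(x | f x == y) tnth w i x] | i < n].
Proof.
apply/ffunP=> h; rewrite !ffunE.
under [RHS]eq_bigr => i _ do rewrite tnth_mktuple ffunE.
rewrite (bigA_distr_big_dep (fun i x => f x == h i) (fun l x => tnth w l x)).
apply: eq_big => [g|g _]; last by rewrite ffunE.
apply/eqP/familyP=> [<- l|H]; first by rewrite unfold_in ffunE.
by apply/ffunP=> i; rewrite ffunE; apply/eqP/(H i).
Qed.

Lemma inPbarT_ptensor n m p (w : n.-tuple {ffun 'I_m -> K^o}) (x : Pn K m p) :
  (forall i, \sum_y tnth w i y = 0) -> inPbarT (cmul (ptensor w) x).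
Proof.
move=> w0.
exists [seq (x g, [tuple [ffun y => \sum_(z | g z == y) tnth w i z] | i < n]) |
         g : {ffun 'I_m -> 'I_p} <- enum {ffun 'I_m -> 'I_p}]; split.
  move=> _ /mapP[g _ ->] i /=; rewrite tnth_mktuple -[RHS](w0 i).
  under eq_bigr do rewrite ffunE.
  by rewrite [RHS](partition_big g xpredT).
rewrite big_map big_enum /= cmul_dlEr; apply: eq_bigr => g _.
by rewrite -pushPnE pushPn_ptensor.
Qed.

Lemma reducedTZ n m a (v : Pn K n m) : reducedT v -> reducedT (a *: v).
Proof. by move=> vr k f fj; rewrite cmulZr vr ?scaler0. Qed.

Lemma reducedT_pp n m x (v : Pn K n m) : reducedT v -> reducedT (cmul (pp x) v).
Proof.
move=> vr k f [j fj]; rewrite cmul_suml cmul_sumr big1 // => s _.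
rewrite cmulZl cmulZr cmulA cmul_dl vr ?scaler0 //; exists (s j) => i.
by rewrite !ffunE (inj_eq perm_inj).
Qed.

Lemma reducedT_lt0 k n m (x : Pn K k n) (v : Pn K n m) : (k < n)%N -> reducedT v -> cmul x v = 0.
Proof.
move=> kn vr; rewrite cmul_dlE big1 // => f _; rewrite vr ?scaler0 //.
by apply: noninj_nonsurj; rewrite kn.
Qed.

(** A non-injective self-map of a finite set misses a point, so it kills [v]. *)
Lemma reducedT_ppE n m x (v : Pn K n m) : reducedT v -> cmul x v = cmul (pp x) v.
Proof.
move=> vr; rewrite {1}[x]pp_split cmulDl [X in _ + X]cmul_suml [X in _ + X]big1 ?addr0 // => f f_ninj.
by rewrite cmulZl vr ?scaler0 //; apply: noninj_nonsurj; rewrite leqnn f_ninj orbT.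
Qed.

End ReducedTensors.

(** * A tensor in Pbar^n with a simple permutation part *)

Section SquareTensor.
Variables (K : fieldType) (n : nat).
Hypothesis n2 : (1 < n)%N.

(* -1/2 (x_1 - x_0) (x) (x_1 - x_0) (x) (x_2 - x_0) (x) ... (x) (x_{n-1} - x_0) *)
Definition dfac (i : nat) : {ffun 'I_n -> K^o} :=
  [ffun x : 'I_n => (x == maxn i 1 :> nat)%:R - (x == 0%N :> nat)%:R].
Definition dten : Pn K n n := (- (2%:R)^-1) *: ptensor [tuple dfac i | i < n].

Let o0 : 'I_n := Ordinal (ltnW n2).
Let o1 : 'I_n := Ordinal n2.

Lemma dfac_sum (i : 'I_n) : \sum_x tnth [tuple dfac i | i < n] i x = 0.
Proof.
have sum1 (k : 'I_n) : \sum_(x < n) (x == k :> nat)%:R = 1 :> K.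
  by rewrite (bigD1 k) //= eqxx big1 ?addr0 // => x /negPf; rewrite -val_eqE /= => ->.
have mi : (maxn i 1 < n)%N by rewrite gtn_max ltn_ord.
under eq_bigr do rewrite tnth_mktuple ffunE.
by rewrite sumrB (sum1 (Ordinal mi)) (sum1 o0) subrr.
Qed.

Lemma inPbarT_dten m (x : Pn K n m) : inPbarT (cmul dten x).
Proof. by rewrite cmulZl -cmulZr; apply: inPbarT_ptensor; apply: dfac_sum. Qed.

(** Only the place sent to 0 contributes -1, which the sign of the prefactor cancels; likewise in
    [dten_pft]. *)
Lemma dten_pf1 : dten (pf 1%g) = (2%:R)^-1.
Proof.
rewrite !ffunE (bigD1 o0) //= big1 => [|i i0]; rewrite tnth_mktuple !ffunE perm1 /=.
  by rewrite sub0r mulr1 [_ *: _]mulrNN mulr1.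
have i1 : (0 < i)%N by rewrite lt0n; apply: contra i0 => /eqP i0; apply/eqP/val_inj.
by rewrite (maxn_idPl i1) eqxx (gtn_eqF i1) subr0.
Qed.

Lemma dten_pft : dten (pf (tperm o0 o1)) = (2%:R)^-1.
Proof.
rewrite !ffunE (bigD1 o0) //= (bigD1 o1) //= big1 => [|i /andP[i0 i1]]; rewrite !tnth_mktuple !ffunE.
  by rewrite tpermL tpermR /= sub0r subr0 mulr1 mul1r [_ *: _]mulrNN mulr1.
have i2 : (0 < i)%N by rewrite lt0n; apply: contra i0 => /eqP i0; apply/eqP/val_inj.
by rewrite tpermD 1?eq_sym // (maxn_idPl i2) eqxx (gtn_eqF i2) subr0.
Qed.

(** A non-zero coefficient forces each [i] to go to max(i,1) or to 0. By injectivity the image of 0,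
    either 0 or 1, determines the rest. *)
Lemma dten_pf0 (s : 'S_n) : s != 1%g -> s != tperm o0 o1 -> dten (pf s) = 0.
Proof.
move=> s1 st; rewrite !ffunE.
have [i i0|all] := pickP (fun i : 'I_n => tnth [tuple dfac i | i < n] i (s i) == 0).
  by move/eqP: i0 => /= i0; rewrite (bigD1 i) //= ffunE i0 mul0r; apply: mulr0.
have sP (i : 'I_n) : s i = maxn i 1 :> nat \/ s i = o0.
  have := all i; rewrite tnth_mktuple !ffunE.
  have [e _|_] := eqVneq (s i : nat) (maxn i 1); first by left.
  have [e _|_] := eqVneq (s i : nat) 0%N; first by right; apply: val_inj.
  by rewrite subrr eqxx.
have s_inj := @perm_inj _ s.
have ord_pos (i : 'I_n) : i != o0 -> (0 < i)%N.
  by move=> i0; rewrite lt0n; apply: contra i0 => /eqP i0; apply/eqP/val_inj.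
have [s00|s01] : s o0 = o0 \/ s o0 = o1.
- by have [e|->] := sP o0; [right; apply: val_inj | left].
- case/eqP: s1; apply/permP=> i; rewrite perm1; have [->//|i0] := eqVneq i o0.
  have [e|e] := sP i; last by case/eqP: i0; apply: s_inj; rewrite e s00.
  by apply: val_inj; rewrite /= e (maxn_idPl (ord_pos i i0)).
case/eqP: st; have s10 : s o1 = o0.
  have [e|//] := sP o1; suff : s o1 = s o0 by move/s_inj.
  by rewrite s01; apply: val_inj.
apply/permP=> i; case: tpermP => [->|->|/eqP i0 /eqP i1] //.
have [e|e] := sP i; last by case/eqP: i1; apply: s_inj; rewrite e s10.
by apply: val_inj; rewrite /= e (maxn_idPl (ord_pos i i0)).
Qed.

Lemma pp_dten : pp dten = (2%:R)^-1 *: (dl (idf n) + pm (tperm o0 o1)).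
Proof.
have t1 : tperm o0 o1 != 1%g.
  by apply/eqP=> /permP/(_ o0); rewrite tpermL perm1 => /(congr1 val).
rewrite /pp (bigD1 1%g) //= (bigD1 (tperm o0 o1)) //= big1 ?addr0 => [|s /andP[s1 st]].
  by rewrite dten_pf1 dten_pft /pm pf1 scalerDr.
by rewrite dten_pf0 // scale0r.
Qed.

End SquareTensor.

(** * Exterior powers of P *)

Section Exterior.
Variable K : fieldType.
Hypothesis K0 : forall m, (m%:R == 0 :> K) = (m == 0%N).

Definition alt n : Pn K n n := ysym K n (nseq n 1%N).
Definition lamE n : Pn K n n := (n`!%:R)^-1 *: alt n.

Lemma colGroup_column n (s : 'S_n) : s \in colGroup n (nseq n 1%N).
Proof.
have sumE : sumn (nseq n 1%N) = n by rewrite sumn_nseq mul1n.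
have col0 (i : 'I_n) : colOf (nseq n 1%N) i = 0%N.
  have := @box_rowcol (nseq n 1%N) i; rewrite sumE => /(_ (ltn_ord i)).
  by rewrite /box nth_nseq; case: ifP; rewrite ?ltnS ?leqn0 => // _ /eqP.
by apply/stabP=> i; rewrite !col0.
Qed.

Lemma altE n : alt n = bsym K n (nseq n 1%N).
Proof.
rewrite /alt /ysym /asym (big_pred1 1%g) ?[pm 1%g]/(dl _) ?pf1 ?cmul1r // => s /=.
apply/idP/eqP=> [sR|->]; first exact: rowcol_trivial sR (colGroup_column s).
by apply/stabP=> i; rewrite perm1.
Qed.

Lemma alt_pm n (s : 'S_n) : cmul (alt n) (pm s) = (-1) ^+ odd_perm s *: alt n.
Proof. by rewrite altE; apply: bsym_pm (colGroup_column s). Qed.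

Lemma pm_alt n (s : 'S_n) : cmul (pm s) (alt n) = (-1) ^+ odd_perm s *: alt n.
Proof. by rewrite altE; apply: pm_altsum_stab (colGroup_column s). Qed.

Lemma lamE_pm n (s : 'S_n) : cmul (lamE n) (pm s) = (-1) ^+ odd_perm s *: lamE n.
Proof. by rewrite cmulZl alt_pm !scalerA mulrC. Qed.

Lemma pm_lamE n (s : 'S_n) : cmul (pm s) (lamE n) = (-1) ^+ odd_perm s *: lamE n.
Proof. by rewrite cmulZr pm_alt !scalerA mulrC. Qed.

Lemma fact_neq0 n : n`!%:R != 0 :> K.
Proof. by rewrite K0 -lt0n fact_gt0. Qed.

Lemma lamE_alt n : cmul (lamE n) (alt n) = alt n.
Proof.
rewrite {1}altE cmul_sumr (eq_bigr (fun=> lamE n)) => [|s _]; last first.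
  by rewrite cmulZr lamE_pm scalerA -signr_addb addbb scale1r.
rewrite (eq_bigl xpredT) => [|s]; last exact: colGroup_column.
rewrite sumr_const [#|_|](_ : _ = n`!); last by rewrite -(card_Sn n); apply: eq_card.
by rewrite -scaler_nat scalerA divff ?scale1r ?fact_neq0.
Qed.

Lemma lamE_idem n : cmul (lamE n) (lamE n) = lamE n.
Proof. by rewrite {2}/lamE cmulZr lamE_alt. Qed.

Lemma LamSubP n m (x : Pn K n m) : LamSub x <-> cmul (lamE n) x = x.
Proof.
split=> [[v ->]|xE]; first by rewrite youngE cmulA lamE_alt.
by exists ((n`!%:R)^-1 *: x); rewrite youngE cmulZr -cmulZl.
Qed.

Lemma lamE_noninj n m (f : {ffun 'I_n -> 'I_m}) : ~~ injectiveb f -> cmul (lamE n) (dl f) = 0.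
Proof.
case/injectivePn=> i [j ij fij]; apply: (neg_eq0 K0).
have {1}-> : dl f = cmul (pm (tperm i j)) (dl f) :> Pn K n m.
  by rewrite cmul_dl; congr dl; apply/ffunP=> k; rewrite !ffunE; case: tpermP => [->|->|].
by rewrite cmulA lamE_pm odd_tperm ij expr1 scaleN1r cmulNl.
Qed.

Lemma lamE_gt0 n m (x : Pn K n m) : (m < n)%N -> cmul (lamE n) x = 0.
Proof.
move=> mn; rewrite cmul_dlEr big1 // => f _; rewrite lamE_noninj ?scaler0 //.
apply/negP=> /injectiveP/leq_card; rewrite !card_ord leqNgt mn //.
Qed.

Lemma lamE_pp n x : exists k, cmul (lamE n) (pp x) = k *: lamE n.
Proof.
exists (\sum_s x (pf s) * (-1) ^+ odd_perm s); rewrite cmul_sumr scaler_suml.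
by apply: eq_bigr => s _; rewrite cmulZr lamE_pm scalerA.
Qed.

Lemma lamE_ppE n x : cmul (lamE n) x = cmul (lamE n) (pp x).
Proof.
rewrite {1}[x]pp_split cmulDr [X in _ + X]cmul_sumr [X in _ + X]big1 ?addr0 // => f f_ninj.
by rewrite cmulZr lamE_noninj ?scaler0.
Qed.

Lemma lamE_corner n : cornerK (lamE n).
Proof.
split; [|exact: lamE_idem|].
  move/(congr1 (fun v : Pn K n n => v (idf n))); rewrite !ffunE ysym_id => /eqP.
  by rewrite [_ *: _]mulr1 invr_eq0 (negPf (fact_neq0 n)).
move=> z; have [k kE] := lamE_pp z; exists k.
by rewrite cmulA lamE_ppE kE cmulZl lamE_idem.
Qed.

(** In one of the two directions there are no injections, and [lamE] kills everything else. *)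
Lemma lamE_orth n m (x : Pn K n m) (y : Pn K m n) : n <> m ->
  cmul (cmul (lamE n) (cmul x (lamE m))) (cmul (lamE m) (cmul y (lamE n))) = 0.
Proof.
move=> nm; case: (ltngtP n m) => // [lt|lt].
  by rewrite (cmulA (lamE m) y) (lamE_gt0 y lt) cmul0l cmul0r.
by rewrite (cmulA (lamE n) x) (lamE_gt0 x lt) !cmul0l.
Qed.

End Exterior.

(** * Schur functors of Pbar *)

Section Schur.
Variable K : fieldType.
Hypothesis K0 : forall m, (m%:R == 0 :> K) = (m == 0%N).

Definition schE n la : Pn K n n := (alpha K n la)^-1 *: cmul (ysym K n la) (dten K n).

(** The first row holds places 0 and 1, so the row symmetrizer absorbs their transposition. *)
Definition wide n la := [/\ is_partition la, sumn la = n & (1 < nth 0 la 0)%N].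

Lemma wideP la : is_partition la -> la <> [::] -> la <> nseq (sumn la) 1%N ->
  wide (sumn la) la.
Proof.
move=> la_p la0 la1; split=> //; rewrite ltnNge; apply/negP=> le1; case: la1.
have E : la = nseq (size la) 1%N.
  apply/all_pred1P/(all_nthP 0%N) => i il /=; rewrite eqn_leq; apply/andP; split.
    rewrite leqNgt; apply/negP=> i1; have := box_up la_p (leq0n i) (i1 : box la i 1).
    by rewrite /box ltnNge le1.
  by case/andP: la_p => _ /(all_nthP 0%N)/(_ i il).
by rewrite [in RHS]E sumn_nseq mul1n -E.
Qed.

Lemma wide_gt1 n la : wide n la -> (1 < n)%N.
Proof.
case=> _ <-; case: la => [|x la] //= x1; exact: leq_trans (leq_addr _ _).
Qed.

Variables (n : nat) (la : seq nat).
Hypothesis la_w : wide n la.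
Let n2 := wide_gt1 la_w.
Let la_p : is_partition la. Proof. by case: la_w. Qed.
Let la_n : sumn la = n. Proof. by case: la_w. Qed.
Let tau : 'S_n := tperm (Ordinal (ltnW n2)) (Ordinal n2).
Let y := ysym K n la.
Let e := schE n la.
Let a0 : alpha K n la != 0. Proof. exact: alpha_neq0. Qed.

Lemma tau_row : tau \in rowGroup n la.
Proof.
have row0 i : (i <= 1)%N -> rowOf la i = 0%N.
  move=> i1; apply/eqP; rewrite -leqn0 -ltnS rowOf_lt; last first.
    by rewrite la_n (leq_ltn_trans i1 n2).
  have [_ _] := la_w; case: (la) => //= x l x1; rewrite take0 /= addn0.
  exact: leq_ltn_trans i1 x1.
by apply: stab_tperm; rewrite !row0.
Qed.

Lemma odd_tau : odd_perm tau = true.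
Proof. by rewrite odd_tperm. Qed.

Lemma half2 (V : lmodType K) (v : V) : (2%:R)^-1 *: (v + v) = v.
Proof. by rewrite -mulr2n -scaler_nat scalerA mulVf ?scale1r ?K0. Qed.

Lemma ysym_tau : cmul y (pm tau) = y.
Proof. by rewrite /y /ysym -cmulA asym_pm // tau_row. Qed.

Lemma ysym_pp_dten : cmul y (pp (dten K n)) = y.
Proof. by rewrite (pp_dten K n2) cmulZr cmulDr cmul1r -/tau ysym_tau half2. Qed.

Lemma ysym_dten_reducedT m (v : Pn K n m) : reducedT v -> cmul y (cmul (dten K n) v) = cmul y v.
Proof. by move=> vr; rewrite (reducedT_ppE _ vr) cmulA ysym_pp_dten. Qed.

Lemma schE_reducedTE m (v : Pn K n m) : reducedT v -> cmul e v = (alpha K n la)^-1 *: cmul y v.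
Proof. by move=> vr; rewrite cmulZl -cmulA ysym_dten_reducedT. Qed.

Lemma ysym_reducedT m (v : Pn K n m) : reducedT v -> reducedT (cmul y v).
Proof. by move=> vr; rewrite /y -pp_ysym; apply: reducedT_pp. Qed.

(** On reduced tensors [e] acts as [y] divided by [alpha], so it fixes the image of [y]. Conversely
    e x is [y] applied to a multiple of [dten] x, which lies in Pbar^n. *)
Lemma SchurBarSubP m (x : Pn K n m) : SchurBarSub la x <-> cmul e x = x.
Proof.
split=> [[v [vP ->]]|xE].
  have vr := inPbarT_reducedT vP; rewrite youngE schE_reducedTE; last exact: ysym_reducedT.
  by rewrite cmulA ysym_sq // cmulZl scalerA mulVf // scale1r.
exists (cmul (dten K n) ((alpha K n la)^-1 *: x)); split; first exact: inPbarT_dten.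
by rewrite youngE !cmulZr cmulA -cmulZl.
Qed.

Lemma schE_reducedT : reducedT e.
Proof.
apply: reducedTZ; apply: ysym_reducedT; apply: inPbarT_reducedT.
by rewrite -[dten K n]cmul1r; apply: inPbarT_dten.
Qed.

Lemma schE_idem : cmul e e = e.
Proof.
apply/SchurBarSubP; exists (cmul (dten K n) ((alpha K n la)^-1 *: dl (idf n))).
by split; [apply: inPbarT_dten | rewrite youngE !cmulZr cmul1r].
Qed.

Lemma pp_schE : pp e = (alpha K n la)^-1 *: y.
Proof. by rewrite ppZ pp_cmul pp_ysym ysym_pp_dten. Qed.

(** Since [e] is reduced, [z] acts by its permutation part and [ysym_scalar] applies. *)
Lemma schE_corner : cornerK e.
Proof.
split; [|exact: schE_idem|].
  move/(congr1 (@pp K n)); rewrite pp_schE pp0 => /(congr1 (fun v : Pn K n n => v (idf n))).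
  by rewrite !ffunE ysym_id => /eqP; rewrite [_ *: _]mulr1 invr_eq0 (negPf a0).
move=> z; have [k kE] := ysym_scalar K0 z la_p la_n; exists ((alpha K n la)^-1 * k).
rewrite (reducedT_ppE _ schE_reducedT) schE_reducedTE; last exact: reducedT_pp schE_reducedT.
have -> : cmul y (cmul (pp z) e) = (alpha K n la)^-1 *: cmul (cmul y (cmul (pp z) y)) (dten K n).
  by rewrite /e /schE !cmulZr !cmulA.
by rewrite kE cmulZl /e /schE !scalerA mulrAC.
Qed.

(** One factor already vanishes: the first if k <= n, the second if k > n. *)
Lemma lamE_schE_orth k (x : Pn K k n) (z : Pn K n k) :
  cmul (cmul (lamE K k) (cmul x e)) (cmul e (cmul z (lamE K k))) = 0.
Proof.
have [kn|nk] := leqP k n.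
  suff -> : cmul (lamE K k) (cmul x e) = 0 by rewrite cmul0l.
  move: kn; rewrite leq_eqVlt => /predU1P[kn|kn]; last first.
    by rewrite (reducedT_lt0 _ kn schE_reducedT) cmul0r.
  move: x {z}; rewrite kn => x; have [c cE] := lamE_pp x.
  rewrite (reducedT_ppE _ schE_reducedT) cmulA cE cmulZl /e /schE cmulZr cmulA.
  suff -> : cmul (lamE K n) (ysym K n la) = 0 by rewrite cmul0l !scaler0.
  (* The transposition [tau] is absorbed by [asym] but changes the sign of [lamE]. *)
  have la0 : cmul (lamE K n) (asym K n la) = 0.
    apply: (neg_eq0 K0); rewrite -{1}(pm_asym K tau_row) cmulA lamE_pm // odd_tau.
    by rewrite expr1 scaleN1r cmulNl.
  rewrite /ysym cmulA /bsym [cmul (lamE K n) _]cmul_sumr [LHS]cmul_suml big1 // => q _.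
  by rewrite cmulZr lamE_pm // scalerA cmulZl la0 scaler0.
suff -> : cmul e (cmul z (lamE K k)) = 0 by rewrite cmul0r.
rewrite [cmul z _]cmul_dlE cmul_sumr big1 // => f _; rewrite cmulZr.
suff -> : cmul e (cmul (dl f) (lamE K k)) = 0 by rewrite scaler0.
(* Swapping two missed points fixes [g] and changes the sign of [lamE]. *)
have noninj0 (g : {ffun 'I_n -> 'I_k}) : ~~ injectiveb g -> cmul (dl g) (lamE K k) = 0.
  case/(noninj_miss2 nk)=> j1 [j2 [j12 g1 g2]]; apply: (neg_eq0 K0).
  have {1}-> : dl g = cmul (dl g) (pm (tperm j1 j2)) :> Pn K n k.
    rewrite cmul_dl; congr dl; apply/ffunP=> i; rewrite !ffunE.
    by rewrite tpermD // eq_sym.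
  by rewrite -cmulA pm_lamE // odd_tperm j12 expr1 scaleN1r cmulNr.
have [f_inj|f_ninj] := boolP (injectiveb f); last by rewrite noninj0 ?cmul0r.
set v := cmul (dl f) _.
have tv : cmul (pm tau) v = - v.
  rewrite /v cmulA; set i0 := Ordinal (ltnW n2); set i1 := Ordinal n2.
  have -> : cmul (pm tau) (dl f) = cmul (dl f) (pm (tperm (f i0) (f i1))) :> Pn K n k.
    rewrite !cmul_dl; congr dl; apply/ffunP=> i; rewrite !ffunE.
    by apply: inj_tperm; apply/injectiveP.
  by rewrite -cmulA pm_lamE // odd_tperm (inj_eq (injectiveP _ f_inj)) expr1 scaleN1r cmulNr.
(* The permutation part of [dten] averages [v] with its negative, and the non-injective part gives
   non-injective composites with [f]. *)
have dv : cmul (dten K n) v = 0.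
  rewrite [dten K n]pp_split cmulDl [X in _ + X]cmul_suml [X in _ + X]big1 ?addr0.
    by rewrite (pp_dten K n2) cmulZl cmulDl cmul1l -/tau tv subrr scaler0.
  move=> g g_ninj; rewrite cmulZl /v cmulA cmul_dl noninj0 ?scaler0 //.
  apply: contra g_ninj => /injectiveP fg; apply/injectiveP=> i j gij.
  by apply: fg; rewrite !ffunE gij.
by rewrite cmulZl -cmulA dv cmul0r scaler0.
Qed.

End Schur.

Lemma schE_orth (K : fieldType) (K0 : forall m, (m%:R == 0 :> K) = (m == 0%N))
  n m la mu (x : Pn K n m) (z : Pn K m n) : wide n la -> wide m mu -> la <> mu ->
  cmul (cmul (schE K n la) (cmul x (schE K m mu))) (cmul (schE K m mu) (cmul z (schE K n la))) = 0.
Proof.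
move=> la_w mu_w lamu; have lar := schE_reducedT K la_w; have mur := schE_reducedT K mu_w.
case: (ltngtP n m) => [nm|nm|nm].
- by rewrite (reducedT_lt0 x nm mur) cmul0r cmul0l.
- by rewrite (reducedT_lt0 z nm lar) !cmul0r.
case: m / nm x z mu_w mur => x z mu_w mur.
have [la_p la_n _] := la_w; have [mu_p mu_n _] := mu_w.
have prod0 l l' w : wide n l -> wide n l' ->
    (forall u, cmul (ysym K n l) (cmul (pp u) (ysym K n l')) = 0) ->
    cmul (schE K n l) (cmul w (schE K n l')) = 0.
  move=> lw lw' H; have l'r := schE_reducedT K lw'.
  rewrite (reducedT_ppE _ l'r) (schE_reducedTE K0 lw); last exact: reducedT_pp.
  have -> : cmul (ysym K n l) (cmul (pp w) (schE K n l')) =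
      (alpha K n l')^-1 *: cmul (cmul (ysym K n l) (cmul (pp w) (ysym K n l'))) (dten K n).
    by rewrite /schE !cmulZr !cmulA.
  by rewrite H cmul0l !scaler0.
have [H|H] := ysym_orth K0 la_p mu_p la_n mu_n lamu.
  by rewrite (prod0 mu la z) ?cmul0r.
by rewrite (prod0 la mu x) ?cmul0l.
Qed.

(** * The listed idempotents: orthogonality, generation of the unit ideal, classification *)

Definition idxdim (i : FAidx) := match i with IdxLam n => n | IdxSchur la => sumn la end.

Definition idxE (K : fieldType) (i : FAidx) : Pn K (idxdim i) (idxdim i) :=
  match i with IdxLam n => lamE K n | IdxSchur la => schE K (sumn la) la end.

Section Listed.
Variable K : fieldType.
Hypothesis K0 : forall m, (m%:R == 0 :> K) = (m == 0%N).

Lemma valid_wide la : validIdx (IdxSchur la) -> wide (sumn la) la.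
Proof. by case=> la_p [la0 la1]; apply: wideP. Qed.

Lemma idxE_corner i : validIdx i -> cornerK (idxE K i).
Proof.
case: i => [n _|la /valid_wide la_w]; first exact: lamE_corner.
exact: schE_corner.
Qed.

Lemma isoIdx_retract (Q : FAmod K) i : validIdx i -> isoIdx Q i <-> retract Q (idxE K i).
Proof.
case: i => [n _|la /valid_wide la_w] /=; apply: isoSub_retract.
- exact: lamE_idem.
- by move=> m x; apply: LamSubP.
- exact: schE_idem.
- by move=> m x; apply: SchurBarSubP.
Qed.

Lemma isoIdx_inj (Q : FAmod K) i j : validIdx i -> validIdx j ->
  isoIdx Q i -> isoIdx Q j -> i = j.
Proof.
have LS n la : validIdx (IdxSchur la) ->
    retract Q (lamE K n) -> retract Q (schE K (sumn la) la) -> False.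
  move=> /valid_wide la_w Qn Qla; have [e0 _ _] := lamE_corner K0 n.
  by have [x [y xy]] := retract_factor Qn Qla; case: e0; rewrite -xy lamE_schE_orth.
move=> vi vj /(isoIdx_retract _ vi) Qi /(isoIdx_retract _ vj) Qj.
case: i j vi vj Qi Qj => [n|la] [m|mu] vi vj Qi Qj.
- have [->//|/eqP nm] := eqVneq n m; have [e0 _ _] := idxE_corner vi.
  by have [x [y xy]] := retract_factor Qi Qj; case: e0; rewrite -xy; apply: lamE_orth.
- by case: (LS n mu).
- by case: (LS m la).
have [->//|/eqP lamu] := eqVneq la mu; have [e0 _ _] := idxE_corner vi.
have [x [y xy]] := retract_factor Qi Qj; case: e0; rewrite -xy.
by apply: schE_orth; rewrite //; apply: valid_wide.
Qed.

Definition vidx := {i : FAidx | validIdx i}.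
Definition vdim (i : vidx) := idxdim (sval i).
Definition vE (i : vidx) : Pn K (vdim i) (vdim i) := idxE K (sval i).

Definition inIdeal a b (x : Pn K a b) :=
  exists s : seq {i : vidx & (Pn K a (vdim i) * Pn K (vdim i) b)%type},
    x = \sum_(t <- s) cmul (tagged t).1 (cmul (vE (tag t)) (tagged t).2).

Lemma inIdeal0 a b : inIdeal (0 : Pn K a b).
Proof. by exists [::]; rewrite big_nil. Qed.

Lemma inIdealD a b (x y : Pn K a b) : inIdeal x -> inIdeal y -> inIdeal (x + y).
Proof. by move=> [s ->] [t ->]; exists (s ++ t); rewrite big_cat. Qed.

Lemma inIdeal_cmul a b c d (u : Pn K a b) (x : Pn K b c) (v : Pn K c d) :
  inIdeal x -> inIdeal (cmul u (cmul x v)).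
Proof.
move=> [s ->].
exists [seq Tagged (fun i => (Pn K a (vdim i) * Pn K (vdim i) d)%type)
  (cmul u (tagged t).1, cmul (tagged t).2 v) | t <- s].
by rewrite big_map cmul_suml cmul_sumr; apply: eq_bigr => t _; rewrite /= !cmulA.
Qed.

Lemma inIdealZ a b k (x : Pn K a b) : inIdeal x -> inIdeal (k *: x).
Proof.
by move/(inIdeal_cmul (k *: dl (idf a)) (dl (idf b))); rewrite cmul1r cmulZl cmul1l.
Qed.

Lemma inIdeal_sum a b I (r : seq I) (P : pred I) (F : I -> Pn K a b) :
  (forall i, P i -> inIdeal (F i)) -> inIdeal (\sum_(i <- r | P i) F i).
Proof. by apply: big_ind; [apply: inIdeal0 | apply: inIdealD]. Qed.

Lemma inIdeal_vE i : inIdeal (vE i).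
Proof.
exists [:: Tagged (fun j => (Pn K (vdim i) (vdim j) * Pn K (vdim j) (vdim i))%type)
  (dl (idf _), dl (idf _))].
by rewrite big_seq1 /= cmul1l cmul1r.
Qed.

(** A missed point [j] lets [f] factor through the set with [n.-1] elements, where the identity lies
    in the ideal. *)
Lemma inIdeal_noninj n (f : {ffun 'I_n -> 'I_n}) :
  (forall m, (m < n)%N -> inIdeal (dl (idf m) : Pn K m m)) ->
  ~~ injectiveb f -> inIdeal (dl f : Pn K n n).
Proof.
move=> IH f_ninj; have [j fj] : exists j, forall i, f i != j.
  by apply: noninj_nonsurj; rewrite leqnn f_ninj orbT.
have /fin_all_exists[f1 f1E] i : exists k, fintype.lift j k = f i.
  have ji : j != f i by rewrite eq_sym.
  by have [k -> _] := unlift_some ji; exists k.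
have -> : dl f = cmul (dl (finfun f1)) (cmul (dl (idf _)) (dl [ffun k => fintype.lift j k])) :> Pn K n n.
  rewrite cmul1l cmul_dl; congr dl; apply/ffunP=> i.
  by rewrite !ffunE f1E.
by apply/inIdeal_cmul/IH; rewrite ltn_predL (leq_ltn_trans _ (ltn_ord j)).
Qed.

(** For a column (the empty partition included) this is a multiple of [lamE]. Otherwise it is a
    multiple of the permutation part of [schE], which differs from [schE] by non-injective maps. *)
Lemma inIdeal_ysym n la :
  (forall m, (m < n)%N -> inIdeal (dl (idf m) : Pn K m m)) ->
  is_partition la -> sumn la = n -> inIdeal (ysym K n la).
Proof.
move=> IH la_p la_n; have [la1|la1] := eqVneq la (nseq n 1%N).
  have -> : ysym K n la = n`!%:R *: lamE K n.
    by rewrite la1 /lamE scalerA divff ?scale1r ?fact_neq0.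
  by apply: inIdealZ; apply: (inIdeal_vE (exist _ (IdxLam n) I)).
case: n / la_n IH la1 => IH la1.
have la0 : la <> [::] by move=> la0; rewrite la0 in la1.
have va : validIdx (IdxSchur la) by split=> //; split=> //; apply/eqP.
have la_w := valid_wide va.
have yE : ysym K (sumn la) la = alpha K (sumn la) la *: pp (schE K (sumn la) la).
  by rewrite pp_schE // scalerA divff ?scale1r ?alpha_neq0.
rewrite yE; apply: inIdealZ.
have eE := pp_split (schE K (sumn la) la).
have -> := canRL (addrK _) (esym eE); rewrite -scaleN1r.
apply: inIdealD; first exact: (inIdeal_vE (exist _ (IdxSchur la) va)).
apply/inIdealZ/inIdeal_sum => f f_ninj; apply: inIdealZ; exact: inIdeal_noninj.
Qed.

(** Strong induction: [one_zsym] writes the identity through conjugates of Young symmetrizers,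
    handled by [inIdeal_ysym]. *)
Lemma inIdeal1 n : inIdeal (dl (idf n) : Pn K n n).
Proof.
elim/ltn_ind: n => n IH; have [r [rP ->]] := one_zsym K0 n.
rewrite big_seq; apply: inIdeal_sum => t /rP[t_p t_n]; apply/inIdealZ/inIdeal_sum => g _.
exact/inIdeal_cmul/inIdeal_ysym.
Qed.

End Listed.

Theorem mainTheorem11 (K : fieldType) (hK : [pchar K]%R =i pred0) :
  (forall Q : FAmod K, projective Q -> indecomposable Q ->
     exists! i, validIdx i /\ isoIdx Q i) /\
  (forall i, validIdx i ->
     (exists Q : FAmod K, isoIdx Q i) /\
     (forall Q : FAmod K, isoIdx Q i -> projective Q /\ indecomposable Q)) /\
  (forall i j, validIdx i -> validIdx j ->
     forall Q : FAmod K, isoIdx Q i -> isoIdx Q j -> i = j).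
Proof.
have K0 m : (m%:R == 0 :> K)%R = (m == 0%N) by move: m; apply/pcharf0P.
have inj (Q : FAmod K) i j vi vj := @isoIdx_inj K K0 Q i j vi vj.
split; last split=> [i vi|i j vi vj Q]; last exact: inj.
- move=> Q Qproj Qind.
  have [[i vi] Qi] := projective_indecomposable_retract
    (fun i : vidx => idxE_corner K0 (proj2_sig i)) (inIdeal1 K0) Qproj Qind.
  have Qiso : isoIdx Q i by apply/(isoIdx_retract K0 Q vi).
  by exists i; split=> // j [vj Qj]; apply: (inj Q).
split.
  have [_ ee _] := idxE_corner K0 vi.
  by exists (fixedMod (idxE K i)); apply/(isoIdx_retract K0 _ vi)/fixedMod_retract.
move=> Q /(isoIdx_retract K0 Q vi) Qi; split; first exact: retract_projective Qi.
exact: retract_indecomposable (idxE_corner K0 vi) Qi.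
Qed.
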